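(* Let $\mu$ be a unimodular probability measure on $\mathcal{G}_*$ (supported on connected, infinite graphs of uniformly bounded degree). Consider the BRW on $G$ with offspring distribution $(p_k)_{k\ge1}$ ($p_0=0$, $p_1<1$, mean $m$) and simple random walk movement. Then for $\mu$-almost every $(G,o)$: if $m>1/\rho(G)$ the BRW is strongly recurrent, and if $m\le 1/\rho(G)$ it is transient.
   Context: Graphs are infinite, connected, locally finite with uniformly bounded degrees. The simple random walk (SRW) on $G$ has transition probabilities $p(x,y)=1/\deg(x)$ if $x\sim y$ and $0$ otherwise; $\rho(G)=\limsup_{n\to\infty}(p^{(n)}(x,y))^{1/n}$ is its spectral radius (independent of $x,y$). Branching random walk (BRW) with offspring distribution $(p_k)_{k\ge0}$, $p_0=0$, $p_1<1$, $m=\sum_k kp_k$: it is the tree-indexed random walk $(S_v)_{v\in\mathbb{T}}$ where $\mathbb{T}$ is a Galton–Watson tree with offspring law $(p_k)$ rooted at $\mathbf r$, $S_{\mathbf r}=o$, and given $S_{v^-}=y$ (where $v^-$ is the parent of $v$), $S_v$ is chosen with law $p(y,\cdot)$, independently over vertices. For $x\in G$ let $\alpha(x)$ be the probability that the BRW started at $x$ visits $x$ infinitely often (i.e. infinitely many $v$ have $S_v=x$). The BRW is strongly recurrent if $\alpha(x)=1$ for all $x$, transient if $\alpha(x)=0$ for all $x$ (these do not depend on $x$ by irreducibility). $\mathcal{G}_*$ is the space of isomorphism classes $[G,o]$ of rooted locally finite connected graphs with the local topology, $\mathcal{G}_{**}$ the analogous space with an ordered pair of distinguished vertices. A Borel probability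 measure $\mu$ on $\mathcal{G}_*$ is unimodular if for every Borel $f:\mathcal{G}_{**}\to[0,\infty]$, $\int\sum_{x\in V(G)}f(G,o,x)\,d\mu([G,o])=\int\sum_{x\in V(G)}f(G,x,o)\,d\mu([G,o])$. A unimodular random graph (URG) is a random rooted graph with unimodular law. *)

(* Defs.v *)
From HB Require Import structures.
From mathcomp Require Import all_boot all_order all_algebra.
From mathcomp Require Import all_classical all_reals all_analysis.
From mathcomp Require Import measurable_realfun.

Set Implicit Arguments.
Unset Strict Implicit.
Unset Printing Implicit Defensive.

Import Order.TTheory GRing.Theory Num.Theory.
Local Open Scope classical_set_scope.
Local Open Scope ring_scope.

(* An infinite, connected, locally finite graph has countably many     *)
(* vertices, so up to isomorphism its vertex set is nat; we root it at *)
(* the vertex 0.                                                        *)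
Definition graph := nat -> seq nat.
HB.instance Definition _ := gen_eqMixin graph.
HB.instance Definition _ := gen_choiceMixin graph.
HB.instance Definition _ := isPointed.Build graph (fun _ => [::]).

Definition bdd_graph (D : nat) (g : graph) : Prop :=
  [/\ (forall x y, (y \in g x) = (x \in g y)),
      (forall x, x \notin g x),
      (forall x, uniq (g x)),
      (forall x y, exists s : seq nat,
          path (fun a b => b \in g a) x s /\ last x s = y)
    & (forall x, (size (g x) <= D)%N)].

(* Cylinder sets generate the measurable structure on graphs (this is
   the Borel sigma-algebra of the local topology on labelled graphs). *)
Definition graph_cyl : set (set graph) :=
  [set A | exists (i : nat) (s : seq nat), A = [set g : graph | g i = s]].

Definition Gr := g_sigma_algebraType graph_cyl.

(* Invariance under relabelling: isomorphism-invariant functions of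
   (G, o, x), i.e. functions on G_** . *)
Definition iso_invariant (R : realType) (F : graph -> nat -> nat -> \bar R) :=
  forall (g1 g2 : graph) (s t : nat -> nat), cancel s t -> cancel t s ->
    (forall x, perm_eq (map s (g1 x)) (g2 (s x))) ->
    forall o x, F g2 (s o) (s x) = F g1 o x.

Definition unimodular (R : realType) (nu : probability Gr R) : Prop :=
  forall F : graph -> nat -> nat -> \bar R,
    (forall g o x, (0 <= F g o x)%E) ->
    (forall o x, measurable_fun [set: Gr] (fun g : Gr => F g o x)) ->
    iso_invariant F ->
    (\int[nu]_(g in [set: Gr]) (\sum_(x <oo) F g 0%N x))%E =
    (\int[nu]_(g in [set: Gr]) (\sum_(x <oo) F g x 0%N))%E.

Definition srw (R : realType) (g : graph) (x y : nat) : R :=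
  if y \in g x then (size (g x))%:R^-1 else 0.

Fixpoint srw_n (R : realType) (g : graph) (n : nat) (x y : nat) : R :=
  match n with
  | 0 => (x == y)%:R
  | n'.+1 => \sum_(z <- g x) srw R g x z * srw_n R g n' z y
  end.

Definition rho (R : realType) (g : graph) : R :=
  limn_sup (fun n : nat => (srw_n R g n 0%N 0%N) `^ (n%:R^-1)).

Definition offspring (R : realType) (p : nat -> R) : Prop :=
  [/\ (forall k, 0 <= p k),
      (\sum_(k <oo) (p k)%:E = 1)%E,
      p 0%N = 0
    & p 1%N < 1].

Definition mean (R : realType) (p : nat -> R) : \bar R :=
  (\sum_(k <oo) (k%:R * p k)%:E)%E.

(* Branching random walk as a tree-indexed random walk.                 *)
(* Vertices of the Ulam-Harris tree are words (seq nat); the children   *)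
(* of w are i :: w.  K w = number of children of w; Y v y = position of *)
(* v given that its parent sits at y (law p(y,.)).  All K w, Y v y are  *)
(* mutually independent.                                                *)
Definition word := seq nat.

Fixpoint in_tree (T : Type) (K : word -> T -> nat) (om : T) (v : word) : bool :=
  match v with
  | [::] => true
  | i :: w => (i < K w om)%N && in_tree K om w
  end.

Fixpoint pos (T : Type) (Y : word -> nat -> T -> nat) (x : nat) (om : T)
    (v : word) : nat :=
  match v with
  | [::] => x
  | i :: w => Y (i :: w) (pos Y x om w) om
  end.

Definition mutually_independent (R : realType) (d : measure_display)
    (Om : measurableType d) (P : probability Om R) (I : eqType)
    (Z : I -> Om -> nat) : Prop :=
  forall (s : seq I), uniq s -> forall A : I -> set nat,
    P (\bigcap_(i in [set` s]) (Z i @^-1` A i)) =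
    (\prod_(i <- s) P (Z i @^-1` A i))%E.

Definition brw_var (Om : Type) (K : word -> Om -> nat)
  (Y : word -> nat -> Om -> nat) (i : (word + (word * nat))%type) : Om -> nat :=
  match i with inl w => K w | inr vy => Y vy.1 vy.2 end.

Definition brw_realization (R : realType) (g : graph) (p : nat -> R)
    (d : measure_display) (Om : measurableType d) (P : probability Om R)
    (K : word -> Om -> nat) (Y : word -> nat -> Om -> nat) : Prop :=
  [/\ (forall w, measurable_fun [set: Om] (K w)),
      (forall v y, measurable_fun [set: Om] (Y v y)),
      (forall w k, P (K w @^-1` [set k]) = (p k)%:E),
      (forall v y z, P (Y v y @^-1` [set z]) = (srw R g y z)%:E)
    & mutually_independent P (brw_var K Y)].

Definition visits_io (Om : Type) (K : word -> Om -> nat)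
    (Y : word -> nat -> Om -> nat) (x : nat) : set Om :=
  [set om | infinite_set [set v : word | in_tree K om v /\ pos Y x om v = x]].

(* Main.v *)
Require Import Defs.
From HB Require Import structures.
From mathcomp Require Import all_boot all_order all_algebra.
From mathcomp Require Import all_classical all_reals all_analysis.
From mathcomp Require Import measurable_realfun.
From mathcomp Require Import ring lra.

Set Implicit Arguments.
Unset Strict Implicit.
Unset Printing Implicit Defensive.

Import Order.TTheory GRing.Theory Num.Theory.
Import numFieldNormedType.Exports.
Local Open Scope classical_set_scope.
Local Open Scope ring_scope.

(* Let [s o x] be the probability that the process started at [x] visits [o]
   infinitely often and let [G t = 1 - phi (1 - t)], [phi] the generating
   function of [p].  Branching at the root gives [s = G (avg s)], where [avg] is
   the one-step averaging operator of the simple random walk.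

   If [mean p > 1 / rho], some [n] makes the embedded process of returns to the
   root after [n] steps supercritical, so that [s o root] is bounded below by a
   constant independent of [o]; hence [u x = inf_o s o x] is positive at the root.
   The function [u] is isomorphism-invariant and satisfies
   [u >= avg u + (1 - p 1) * avg u * (1 - avg u)].  Transporting the mass [u o]
   from [o] to each neighbour gives [E (deg * (u - avg u)) = 0] at the root, so
   [u = avg u] and [u] is 0 or 1 there.  Finally [s o x = 1] propagates along
   edges.

   If [mean p <= z = 1 / rho], the first-passage generating function
   [W x = F (x, o | z)] is finite with [z * avg W o <= 1] (renewal equation), and
   the strong Markov property gives [s o x <= s o o * W x].  As
   [G t <= z * t - (1 - p 1) * t ^ 2], this forces [s o o = 0], at criticality
   too. *)

(** * Generating functions *)

Section GeneratingFunction.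
Variables (R : realType) (p : nat -> R).

(** [fine] loses nothing on [0, 1], where the series is bounded by 1 ([pgfE]). *)
Definition pgf (s : R) : R := fine (\sum_(k <oo) (p k * s ^+ k)%:E)%E.

Hypothesis hp : offspring p.

Let p_ge0 k : 0 <= p k. Proof. by case: hp. Qed.

Lemma psum_le_series (a : nat -> R) (x : \bar R) n : (forall k, 0 <= a k) ->
  (\sum_(k <oo) (a k)%:E)%E = x -> ((\sum_(0 <= k < n) a k)%:E <= x)%E.
Proof.
move=> a0 <-; rewrite -sumEFin.
by apply: nneseries_lim_ge => k _ _; rewrite lee_fin.
Qed.

Lemma series_le (a : nat -> R) (B : R) : (forall k, 0 <= a k) ->
  (forall n, \sum_(0 <= k < n) a k <= B) -> (\sum_(k <oo) (a k)%:E <= B%:E)%E.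
Proof.
move=> a0 aB; apply: lime_le; first by apply: is_cvg_nneseries => k _ _; rewrite lee_fin.
by apply: nearW => n; rewrite sumEFin lee_fin.
Qed.

Lemma offspring_psum_le1 n : \sum_(0 <= k < n) p k <= 1.
Proof. by case: hp => p0 p1 _ _; rewrite -lee_fin; apply: psum_le_series. Qed.

Lemma offspring_psum_gt e : 0 < e -> exists N, 1 - e < \sum_(0 <= k < N) p k.
Proof.
move=> e0; apply: contrapT => /forallNP h.
have: ((1 : \bar R) <= (1 - e)%:E)%E.
  case: hp => p0 <- _ _; apply: series_le => // n.
  by rewrite leNgt; apply/negP/h.
by rewrite lee_fin; lra.
Qed.

Lemma offspring_pos : exists k, 0 < p k.
Proof.
apply: contrapT => /forallNP h.
have := @offspring_psum_gt 1 ltr01.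
move=> [N]; rewrite subrr big1 ?ltxx// => k _.
by apply/eqP; rewrite eq_le p_ge0 andbT leNgt; apply/negP.
Qed.

Lemma pgf_term_ge0 s k : 0 <= s -> 0 <= p k * s ^+ k.
Proof. by move=> s0; rewrite mulr_ge0// exprn_ge0. Qed.

Lemma pgf_psum_le1 s n : 0 <= s <= 1 -> \sum_(0 <= k < n) p k * s ^+ k <= 1.
Proof.
move=> /andP[s0 s1]; apply: le_trans (offspring_psum_le1 n).
by apply: ler_sum => k _; rewrite ler_piMr// exprn_ile1.
Qed.

Lemma pgfE s : 0 <= s <= 1 -> (pgf s)%:E = (\sum_(k <oo) (p k * s ^+ k)%:E)%E.
Proof.
move=> s01; rewrite /pgf fineK// ge0_fin_numE.
  apply: (@le_lt_trans _ _ 1%E); last by rewrite ltry.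
  apply: series_le => [k|n]; last exact: pgf_psum_le1.
  by apply: pgf_term_ge0; case/andP: s01.
by apply: nneseries_ge0 => k _ _; rewrite lee_fin pgf_term_ge0//; case/andP: s01.
Qed.

Lemma pgf_le s B : 0 <= s <= 1 ->
  (forall n, \sum_(0 <= k < n) p k * s ^+ k <= B) -> pgf s <= B.
Proof.
move=> s01 h; rewrite -lee_fin pgfE//; apply: series_le => // k.
by apply: pgf_term_ge0; case/andP: s01.
Qed.

Lemma pgf_psum s n : 0 <= s <= 1 -> \sum_(0 <= k < n) p k * s ^+ k <= pgf s.
Proof.
move=> s01; rewrite -lee_fin pgfE//; apply: psum_le_series => // k.
by apply: pgf_term_ge0; case/andP: s01.
Qed.

Lemma pgf_ge0 s : 0 <= s <= 1 -> 0 <= pgf s.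
Proof. by move=> /(pgf_psum 0); rewrite big_geq. Qed.

Lemma pgf_le1 s : 0 <= s <= 1 -> pgf s <= 1.
Proof. by move=> s01; apply: pgf_le => // n; exact: pgf_psum_le1. Qed.

Lemma pgf_homo s t : 0 <= s -> s <= t -> t <= 1 -> pgf s <= pgf t.
Proof.
move=> s0 st t1; have t01 : 0 <= t <= 1 by rewrite t1 (le_trans s0).
apply: pgf_le => [|n]; first by rewrite s0 (le_trans st).
apply: le_trans (pgf_psum n t01); apply: ler_sum => k _.
by rewrite ler_wpM2l// lerXn2r// nnegrE (le_trans s0).
Qed.

(** Probability that at least one child succeeds, when each child does so independently with
    probability [t]. *)
Definition pgfc (t : R) : R := 1 - pgf (1 - t).

Let compl01 (t : R) : 0 <= t <= 1 -> 0 <= 1 - t <= 1.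
Proof. by move=> /andP[? ?]; apply/andP; split; lra. Qed.

Lemma pgfc_01 t : 0 <= t <= 1 -> 0 <= pgfc t <= 1.
Proof.
move=> /compl01 t01; rewrite /pgfc.
by have := pgf_ge0 t01; have := pgf_le1 t01; move=> *; apply/andP; split; lra.
Qed.

Lemma pgfc_homo s t : 0 <= s -> s <= t -> t <= 1 -> pgfc s <= pgfc t.
Proof.
move=> s0 st t1; rewrite /pgfc lerD2l lerN2.
by apply: pgf_homo; lra.
Qed.

(** As [p 0 = 0] and [s ^ k <= s ^ 2] for [k >= 2], the generating function at [s = 1 - t] is at
    most [p 1 * s + (1 - p 1) * s ^ 2]. The quadratic gain drives the zero-one law. *)
Lemma pgfc_ge t : 0 <= t <= 1 -> t + (1 - p 1%N) * (t * (1 - t)) <= pgfc t.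
Proof.
move=> t01; have /andP[t0 t1] := t01.
suff : pgf (1 - t) <= (1 - t) ^+ 2 + p 1%N * ((1 - t) - (1 - t) ^+ 2).
  by rewrite /pgfc expr2; lra.
set s := 1 - t; have /andP[s0 s1] : 0 <= s <= 1 by exact: compl01.
apply: pgf_le => [|n]; first by rewrite s0.
have p00 : p 0%N = 0 by case: hp.
have pp1 : 0 <= p 1%N * (s - s ^+ 2) by rewrite mulr_ge0// expr2; nra.
apply: (@le_trans _ _ (\sum_(0 <= k < n) p k * s ^+ 2 + p 1%N * (s - s ^+ 2))).
  case: n => [|[|n]]; first by rewrite !big_geq ?add0r.
    by rewrite !big_nat1 p00 !mul0r add0r.
  rewrite !(big_nat_recl n.+1)// !(big_nat_recl n)// p00 !mul0r !add0r expr1.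
  have : \sum_(0 <= i < n) p i.+2 * s ^+ i.+2 <= \sum_(0 <= i < n) p i.+2 * s ^+ 2.
    apply: ler_sum => k _; rewrite ler_wpM2l// -addn2 exprD.
    by rewrite ler_piMl// ?exprn_ge0// exprn_ile1.
  lra.
rewrite lerD2r -mulr_suml ler_piMl ?exprn_ge0//; exact: offspring_psum_le1.
Qed.

Lemma bernoulli_ineq (t : R) k : 0 <= t <= 1 -> 1 - k%:R * t <= (1 - t) ^+ k.
Proof.
move=> /andP[t0 t1]; elim: k => [|k ih]; first by rewrite mul0r subr0 expr0.
rewrite exprS; apply: (@le_trans _ _ ((1 - t) * (1 - k%:R * t))); last first.
  by rewrite ler_wpM2l//; lra.
by rewrite -natr1; have := ler0n R k; nra.
Qed.

(** Bernoulli's inequality with a second-order gain, an equality for exponent 2. The gain is what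
    settles the critical case. *)
Lemma bernoulli_ineq2 (t : R) k : 0 <= t <= 1 ->
  1 - k.+2%:R * t + t ^+ 2 <= (1 - t) ^+ k.+2.
Proof.
move=> /andP[t0 t1]; elim: k => [|k ih]; first by rewrite !expr2; lra.
rewrite exprS; apply: (@le_trans _ _ ((1 - t) * (1 - k.+2%:R * t + t ^+ 2))); last first.
  by rewrite ler_wpM2l//; lra.
rewrite -[k.+3%:R]natr1 expr2; set x := k.+2%:R.
have x2 : 1 <= x by rewrite ler1n.
have : 0 <= (x - t) * (t * t) by rewrite mulr_ge0 ?mulr_ge0//; lra.
by nra.
Qed.

Lemma expr_compl_le (t : R) k : 0 <= t <= 1 ->
  (1 - t) ^+ k <= 1 - k%:R * t + (k%:R * t) ^+ 2.
Proof.
move=> /andP[t0 t1]; elim: k => [|k ih]; first by rewrite mul0r expr0 expr2; lra.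
rewrite exprS; apply: (@le_trans _ _ ((1 - t) * (1 - k%:R * t + (k%:R * t) ^+ 2))).
  by rewrite ler_wpM2l//; lra.
rewrite -natr1 !expr2; set x := k%:R; have x0 : 0 <= x by rewrite ler0n.
have : 0 <= t * (x * t * (x * t)) by rewrite !mulr_ge0.
have : 0 <= x * t * t by rewrite !mulr_ge0.
have : 0 <= t * t by rewrite !mulr_ge0.
by nra.
Qed.

(** Every term with [k >= 2] gains [t ^ 2] by [bernoulli_ineq2]; these terms carry total mass
    [1 - p 1]. *)
Lemma pgfc_le t z : 0 <= t <= 1 -> (mean p <= z%:E)%E ->
  pgfc t <= z * t - (1 - p 1%N) * t ^+ 2.
Proof.
move=> t01 mz; have /andP[t0 t1] := t01.
suff : 1 - z * t + (1 - p 1%N) * t ^+ 2 <= pgf (1 - t) by rewrite /pgfc; lra.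
apply/ler_addgt0Pr => e e0.
(* Half of [e], because the missing mass is multiplied by [1 + t ^ 2 <= 2]. *)
have [N hN] := @offspring_psum_gt (e / 2) ltac:(lra).
have Nz : \sum_(0 <= k < N.+2) k%:R * p k <= z.
  rewrite -lee_fin; apply: le_trans mz; apply: psum_le_series => // k.
  by rewrite mulr_ge0.
have le2 : \sum_(0 <= k < N) p k <= \sum_(0 <= k < N.+2) p k.
  rewrite [leRHS](@big_cat_nat _ _ _ N)//=.
    by rewrite lerDl sumr_ge0.
  by rewrite -addn2 leq_addr.
have h : \sum_(0 <= k < N.+2) p k * (1 - t) ^+ k <= pgf (1 - t).
  by apply: pgf_psum; exact: compl01.
(* The last summand on the left takes back the [t ^ 2] granted to the term [k = 1]. *)
have : \sum_(0 <= k < N.+2) p k * (1 + t ^+ 2) - t * \sum_(0 <= k < N.+2) k%:R * p k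
   - p 1%N * t ^+ 2 <= \sum_(0 <= k < N.+2) p k * (1 - t) ^+ k.
  have p00 : p 0%N = 0 by case: hp.
  rewrite !(big_nat_recl N.+1)// !(big_nat_recl N)// p00 !mul0r.
  rewrite ?mulr0 !add0r expr1 ?mulr1n.
  have : \sum_(0 <= i < N) p i.+2 * (1 + t ^+ 2) - t * \sum_(0 <= i < N) i.+2%:R * p i.+2
     <= \sum_(0 <= i < N) p i.+2 * (1 - t) ^+ i.+2.
    rewrite mulr_sumr -sumrB; apply: ler_sum => k _.
    apply: (@le_trans _ _ (p k.+2 * (1 - k.+2%:R * t + t ^+ 2))); first lra.
    by rewrite ler_wpM2l// bernoulli_ineq2.
  lra.
rewrite -mulr_suml.
have : t * \sum_(0 <= k < N.+2) k%:R * p k <= t * z by rewrite ler_wpM2l.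
have : (1 - e / 2) * (1 + t ^+ 2) <= \sum_(0 <= k < N.+2) p k * (1 + t ^+ 2).
  rewrite -mulr_suml ler_wpM2r//; last lra.
  by rewrite addr_ge0// exprn_ge0.
have : t ^+ 2 <= 1 by rewrite exprn_ile1.
rewrite -mulr_suml.
by nra.
Qed.

Lemma pgfc_le_pow t k : 0 <= t <= 1 -> pgfc t <= 1 - p k * (1 - t) ^+ k.
Proof.
move=> /compl01 t01; rewrite /pgfc lerD2l lerN2.
apply: le_trans (pgf_psum k.+1 t01); rewrite big_nat_recr//= lerDr.
by apply: sumr_ge0 => i _; apply: pgf_term_ge0; case/andP: t01.
Qed.

Lemma mean_gt_psum (x : R) : (x%:E < mean p)%E ->
  exists L, x < \sum_(0 <= k < L) k%:R * p k.
Proof.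
move=> h; apply: contrapT => /forallNP hn.
suff : (mean p <= x%:E)%E by rewrite leNgt h.
apply: series_le => [k|n]; first by rewrite mulr_ge0.
by rewrite leNgt; apply/negP/hn.
Qed.

(** The slope of [pgfc p] at 0 is the mean, possibly infinite. Truncating to [L] terms keeps the
    slope above [x] and makes the second-order error finite. *)
Lemma pgfc_ge_mean (x : R) : (x%:E < mean p)%E ->
  exists2 eta, 0 < eta & forall t, 0 <= t <= eta -> x * t <= pgfc t.
Proof.
move=> /mean_gt_psum [L hL].
set M := \sum_(0 <= k < L) k%:R * p k in hL.
pose C := \sum_(0 <= k < L) k%:R ^+ 2 * p k.
have C0 : 0 <= C by apply: sumr_ge0 => k _; rewrite mulr_ge0// exprn_ge0.
(* This makes the error [t ^ 2 * C] at most [t * (M - x)]; adding 1 to [C] avoids a zero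
   denominator. *)
pose eta := Num.min 1 ((M - x) / (C + 1)).
have hq : 0 < (M - x) / (C + 1) by rewrite divr_gt0//; lra.
have e1 : eta <= 1 by rewrite ge_min lexx.
have e0 : 0 < eta by rewrite lt_min ltr01 hq.
exists eta => [|t /andP[t0 te]]; first exact: e0.
have t1 : t <= 1 by apply: le_trans te _.
have tC : t * (C + 1) <= M - x.
  rewrite -ler_pdivlMr; last lra.
  by apply: le_trans te _; rewrite ge_min lexx orbT.
have t01 : 0 <= 1 - t <= 1 by apply: compl01; rewrite t0.
suff : pgf (1 - t) <= 1 - t * M + t ^+ 2 * C.
  by rewrite /pgfc expr2; nra.
apply: pgf_le => // n.
(* Summing up to [n + L] ensures that the first [L] terms are all present, whatever [n] is. *)
have key : \sum_(0 <= k < n + L) p k * (1 - t) ^+ k <=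
   \sum_(0 <= k < n + L) p k - t * M + t ^+ 2 * C.
  rewrite addnC !(@big_cat_nat _ _ _ L 0 (L + n))//= ?leq_addr//.
  have : \sum_(0 <= i < L) p i * (1 - t) ^+ i <=
         \sum_(0 <= i < L) p i - t * M + t ^+ 2 * C.
    rewrite /M /C !mulr_sumr -sumrB -big_split/=; apply: ler_sum => k _.
    have h : p k * (1 - t) ^+ k <= p k * (1 - k%:R * t + (k%:R * t) ^+ 2).
      by rewrite ler_wpM2l// expr_compl_le// t0.
    by apply: le_trans h _; rewrite exprMn; lra.
  have : \sum_(L <= i < L + n) p i * (1 - t) ^+ i <= \sum_(L <= i < L + n) p i.
    apply: ler_sum => k _; rewrite ler_piMr// exprn_ile1//; lra.
  lra.
have : \sum_(0 <= k < n) p k * (1 - t) ^+ k <= \sum_(0 <= k < n + L) p k * (1 - t) ^+ k.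
  rewrite [leRHS](@big_cat_nat _ _ _ n)//= ?leq_addr//.
  by rewrite lerDl sumr_ge0// => i _; apply: pgf_term_ge0; lra.
by have := offspring_psum_le1 (n + L); lra.
Qed.

End GeneratingFunction.

(** * Visit probabilities *)

Lemma range_nonempty (T : Type) (f : nat -> T) : range f !=set0.
Proof. by exists (f 0%N), 0%N. Qed.

Section Averages.
Variable R : realType.
Implicit Types (g : graph) (f h : nat -> R) (D : nat).

Definition avg g f (x : nat) : R := \sum_(z <- g x) srw R g x z * f z.

Lemma srw_ge0 g x z : 0 <= srw R g x z.
Proof. by rewrite /srw; case: ifP => // _; rewrite invr_ge0. Qed.

Lemma srw_gt0 g x z : z \in g x -> 0 < srw R g x z.
Proof. by move=> zx; rewrite /srw zx invr_gt0 ltr0n; case: (g x) zx. Qed.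

Lemma eq_avg g f h x : (forall z, f z = h z) -> avg g f x = avg g h x.
Proof. by move=> fh; apply: eq_bigr => z _; rewrite fh. Qed.

Lemma avg_homo g f h x : (forall z, f z <= h z) -> avg g f x <= avg g h x.
Proof. by move=> fh; apply: ler_sum => z _; rewrite ler_wpM2l ?srw_ge0. Qed.

Lemma avgZ g c f x : avg g (fun z => c * f z) x = c * avg g f x.
Proof. by rewrite /avg mulr_sumr; apply: eq_bigr => z _; rewrite mulrCA. Qed.

Lemma avgD g f h x : avg g (fun z => f z + h z) x = avg g f x + avg g h x.
Proof. by rewrite /avg -big_split; apply: eq_bigr => z _; rewrite /= mulrDr. Qed.

Lemma avgB g f h x : avg g (fun z => f z - h z) x = avg g f x - avg g h x.
Proof. by rewrite /avg -sumrB; apply: eq_bigr => z _; rewrite /= mulrBr. Qed.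

Lemma avg_ge0 g f x : (forall z, 0 <= f z) -> 0 <= avg g f x.
Proof. by move=> f0; apply: sumr_ge0 => z _; rewrite mulr_ge0 ?srw_ge0. Qed.

Lemma avg_mean g f x :
  avg g f x = (size (g x))%:R^-1 * \sum_(z <- g x) f z.
Proof. by rewrite /avg mulr_sumr; apply: eq_big_seq => z zx; rewrite /srw zx. Qed.

Lemma avg_le1 g f x : (forall z, f z <= 1) -> avg g f x <= 1.
Proof.
(* At an isolated vertex the inverse of 0 is 0, and so is the average. *)
move=> f1; rewrite avg_mean; have [->|n0] := eqVneq (size (g x)) 0%N.
  by rewrite invr0 mul0r.
rewrite mulrC ler_pdivrMr ?ltr0n ?lt0n// mul1r.
apply: (@le_trans _ _ (\sum_(z <- g x) 1)); first exact: ler_sum.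
by rewrite big_const_seq iter_addr_0 count_predT.
Qed.

Lemma avg_01 g f x : (forall z, 0 <= f z <= 1) -> 0 <= avg g f x <= 1.
Proof. by move=> f01; rewrite avg_ge0 ?avg_le1// => z; case/andP: (f01 z). Qed.

Lemma avg_ge_term g f x y : (forall z, 0 <= f z) -> y \in g x ->
  srw R g x y * f y <= avg g f x.
Proof.
move=> f0; rewrite /avg => yx; elim: (g x) yx => //= a l ih.
rewrite inE big_cons => /predU1P[<-|/ih h].
  by rewrite lerDl sumr_ge0// => z _; rewrite mulr_ge0 ?srw_ge0.
by apply: le_trans h _; rewrite lerDr mulr_ge0 ?srw_ge0.
Qed.

Lemma avg_cvg g (F : nat -> nat -> R) f x :
  (forall z, F n z @[n --> \oo] --> f z) ->
  avg g (F n) x @[n --> \oo] --> avg g f x.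
Proof.
move=> Ff; apply: (@cvg_big R _ +%R 0 xpredT) => [|z _].
  exact: add_continuous.
by apply: cvgM; [exact: cvg_cst|exact: Ff].
Qed.

Section BoundedDegree.
Variables (D : nat) (g : graph).
Hypothesis bg : bdd_graph D g.

Lemma bdd_graph_sym x y : (y \in g x) = (x \in g y).
Proof. by case: bg. Qed.

Lemma bdd_graph_uniq x : uniq (g x).
Proof. by case: bg. Qed.

Lemma bdd_graph_ind (Q : nat -> Prop) x y :
  (forall a b, b \in g a -> Q a -> Q b) -> Q x -> Q y.
Proof.
move=> step; case: bg => _ _ _ /(_ x y)[s [xs <-]] _.
elim: s x xs => //= a s ih x /andP[ax sx] Qx.
by apply: ih => //; apply: step ax Qx.
Qed.

(** A path from [x] to the different vertex [x.+1] has a first step. *)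
Lemma deg_gt0 x : (0 < size (g x))%N.
Proof.
case: bg => _ _ _ /(_ x x.+1)[[|a s] [/= xs e]] _.
  by move/n_Sn: e.
by case/andP: xs => + _; case: (g x).
Qed.

Lemma avg_cst c x : avg g (fun=> c) x = c.
Proof.
rewrite avg_mean big_const_seq iter_addr_0 count_predT -[c *+ _]mulr_natl mulrA.
by rewrite mulVf ?mul1r// pnatr_eq0 -lt0n deg_gt0.
Qed.

Lemma avg_eq1 f x z : (forall w, f w <= 1) -> avg g f x = 1 -> z \in g x ->
  f z = 1.
Proof.
move=> f1 a1 zx; apply/eqP; rewrite eq_le f1/=.
have : srw R g x z * (1 - f z) <= avg g (fun w => 1 - f w) x.
  by apply: (avg_ge_term (f := fun w => 1 - f w)) => // w; rewrite subr_ge0.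
by rewrite avgB avg_cst a1 subrr pmulr_rle0 ?srw_gt0// subr_le0.
Qed.

End BoundedDegree.
End Averages.

(** * Hitting recursions and their monotone limits *)

Section HittingProbabilities.
Variables (R : realType) (p : nat -> R).
Hypothesis hp : offspring p.

(* Probability that the process started at [x] visits [o] by generation [M]. *)
Fixpoint hit (g : graph) (o M x : nat) : R :=
  if M is M'.+1 then
    if x == o then 1 else pgfc p (avg g (hit g o M') x)
  else (x == o)%:R.

(* Probability of a visit to [o] within the generations [N, N + M]. *)
Fixpoint hit_within (g : graph) (o N M x : nat) : R :=
  if N is N'.+1 then pgfc p (avg g (hit_within g o N' M) x) else hit g o M x.

(** By monotonicity in [M] and then in [N], the sup and the first inf are limits. [hit_io] is the
    [s] of the overview and [hit_all] its [u]; the infimum over targets removes the dependence on a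
    label. *)
Definition hit_after g o N x : R := sup (range (fun M => hit_within g o N M x)).
Definition hit_io g o x : R := inf (range (fun N => hit_after g o N x)).
Definition hit_all g x : R := inf (range (fun o => hit_io g o x)).

Section FixedGraph.
Variable g : graph.
Implicit Types (o x N M : nat).

Lemma hit_01 o M x : 0 <= hit g o M x <= 1.
Proof.
elim: M x => [|M ih] x /=; first by case: eqP; rewrite ?lexx ?ler01.
by case: eqP => _; rewrite ?ler01 ?lexx// pgfc_01// avg_01.
Qed.

Lemma hit_within_01 o N M x : 0 <= hit_within g o N M x <= 1.
Proof.
by elim: N x => [|N ih] x /=; [exact: hit_01|rewrite pgfc_01// avg_01].
Qed.

Lemma pgfc_avg_homo f h x : (forall z, 0 <= f z) -> (forall z, f z <= h z) ->
  (forall z, h z <= 1) -> pgfc p (avg g f x) <= pgfc p (avg g h x).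
Proof.
by move=> f0 fh h1; apply: pgfc_homo; rewrite ?avg_ge0 ?avg_homo ?avg_le1.
Qed.

Lemma hit_homo o x : {homo (fun M => hit g o M x) : M M' / (M <= M')%N >-> M <= M'}.
Proof.
apply: homo_leq => [y|y z t|M]; [exact: lexx|exact: le_trans|].
elim: M x => [|M ih] x /=.
  by have /= := hit_01 o 1 x; case: eqP => // _ /andP[].
case: eqP => // _; apply: pgfc_avg_homo => // z; first by case/andP: (hit_01 o M z).
by case/andP: (hit_01 o M.+1 z).
Qed.

Lemma hit_within_homo o N x :
  {homo (fun M => hit_within g o N M x) : M M' / (M <= M')%N >-> M <= M'}.
Proof.
move=> M M' MM'; elim: N x => [|N ih] x /=; first exact: hit_homo.
by apply: pgfc_avg_homo => // z;
  [case/andP: (hit_within_01 o N M z)|case/andP: (hit_within_01 o N M' z)].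
Qed.

(** The generations from [N + 1] to [N + 1 + M] form part of the window that starts at [N] and has
    length [M + 1]. *)
Lemma hit_within_S o N M x : hit_within g o N.+1 M x <= hit_within g o N M.+1 x.
Proof.
elim: N x => [|N ih] x; last first.
  by apply: pgfc_avg_homo => // z;
    [case/andP: (hit_within_01 o N.+1 M z)|case/andP: (hit_within_01 o N M.+1 z)].
rewrite /=; case: eqP => // _.
have : forall z, 0 <= hit g o M z <= 1 by move=> z; exact: hit_01.
by move=> /(avg_01 g x)/(pgfc_01 hp)/andP[].
Qed.

Lemma hit_within_cvg o N x :
  hit_within g o N M x @[M --> \oo] --> hit_after g o N x.
Proof.
apply: nondecreasing_cvgn; first exact: hit_within_homo.
by exists 1 => _ [M _ <-]; case/andP: (hit_within_01 o N M x).
Qed.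

Lemma hit_within_le o N M x : hit_within g o N M x <= hit_after g o N x.
Proof.
apply: ub_le_sup; last by exists M.
by exists 1 => _ [m _ <-]; case/andP: (hit_within_01 o N m x).
Qed.

Lemma hit_after_le o N x c :
  (forall M, hit_within g o N M x <= c) -> hit_after g o N x <= c.
Proof. by move=> h; apply: ge_sup; [exact: range_nonempty|move=> _ [M _ <-]]. Qed.

Lemma hit_after_01 o N x : 0 <= hit_after g o N x <= 1.
Proof.
apply/andP; split.
  by apply: le_trans (hit_within_le o N 0 x); case/andP: (hit_within_01 o N 0 x).
by apply: hit_after_le => M; case/andP: (hit_within_01 o N M x).
Qed.

Lemma hit_after_homo o x :
  {homo (fun N => hit_after g o N x) : N N' / (N <= N')%N >-> N' <= N}.
Proof.
apply: (@homo_leq _ _ (fun a b => b <= a)) => [y|y z t|N]; first exact: lexx.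
  by move=> a b; exact: le_trans b a.
apply: hit_after_le => M.
exact: le_trans (hit_within_S _ _ _ _) (hit_within_le _ _ _ _).
Qed.

Lemma hit_after_cvg o x : hit_after g o N x @[N --> \oo] --> hit_io g o x.
Proof.
apply: nonincreasing_cvgn; first exact: hit_after_homo.
by exists 0 => _ [M _ <-]; case/andP: (hit_after_01 o M x).
Qed.

Lemma hit_io_le o N x : hit_io g o x <= hit_after g o N x.
Proof.
apply: ge_inf; last by exists N.
by exists 0 => _ [m _ <-]; case/andP: (hit_after_01 o m x).
Qed.

Lemma hit_io_ge o x c : (forall N, c <= hit_after g o N x) -> c <= hit_io g o x.
Proof. by move=> h; apply: lb_le_inf; [exact: range_nonempty|move=> _ [M _ <-]]. Qed.

Lemma hit_io_01 o x : 0 <= hit_io g o x <= 1.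
Proof.
apply/andP; split; first by apply: hit_io_ge => N; case/andP: (hit_after_01 o N x).
by apply: le_trans (hit_io_le o 0 x) _; case/andP: (hit_after_01 o 0 x).
Qed.

Lemma hit_all_le o x : hit_all g x <= hit_io g o x.
Proof.
apply: ge_inf; last by exists o.
by exists 0 => _ [m _ <-]; case/andP: (hit_io_01 m x).
Qed.

Lemma hit_all_ge x c : (forall o, c <= hit_io g o x) -> c <= hit_all g x.
Proof. by move=> h; apply: lb_le_inf; [exact: range_nonempty|move=> _ [M _ <-]]. Qed.

Lemma hit_all_01 x : 0 <= hit_all g x <= 1.
Proof.
apply/andP; split; first by apply: hit_all_ge => o; case/andP: (hit_io_01 o x).
by apply: le_trans (hit_all_le 0 x) _; case/andP: (hit_io_01 0 x).
Qed.

Let hit_within_pgfc (psi : R -> R) (o N x : nat) : continuous psi ->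
  (psi (avg g (hit_within g o N M) x) @[M --> \oo] -->
     psi (avg g (hit_after g o N) x)) *
  (hit_within g o N.+1 M x @[M --> \oo] --> hit_after g o N.+1 x).
Proof.
move=> cpsi; split; last exact: hit_within_cvg.
by apply: continuous_cvg; [exact: cpsi|apply: avg_cvg => z; exact: hit_within_cvg].
Qed.

Let hit_after_pgfc (psi : R -> R) (o x : nat) : continuous psi ->
  (psi (avg g (hit_after g o N) x) @[N --> \oo] --> psi (avg g (hit_io g o) x)) *
  (hit_after g o N.+1 x @[N --> \oo] --> hit_io g o x).
Proof.
move=> cpsi; split.
  by apply: continuous_cvg; [exact: cpsi|apply: avg_cvg => z; exact: hit_after_cvg].
by rewrite (cvg_shiftS (fun N => hit_after g o N x)); exact: hit_after_cvg.
Qed.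

(* Only continuous bounds on [pgfc] survive the two limits; continuity of
   [pgfc] itself is never needed. *)
Lemma hit_after_lower (psi : R -> R) o N x : continuous psi ->
  (forall t, 0 <= t <= 1 -> psi t <= pgfc p t) ->
  psi (avg g (hit_after g o N) x) <= hit_after g o N.+1 x.
Proof.
move=> cpsi h; have [h1 h2] := hit_within_pgfc o N x cpsi.
apply: ler_cvg_to h1 h2 _; apply: nearW => M; apply: h.
by apply: avg_01 => z; exact: hit_within_01.
Qed.

Lemma hit_after_upper (psi : R -> R) o N x : continuous psi ->
  (forall t, 0 <= t <= 1 -> pgfc p t <= psi t) ->
  hit_after g o N.+1 x <= psi (avg g (hit_after g o N) x).
Proof.
move=> cpsi h; have [h1 h2] := hit_within_pgfc o N x cpsi.
apply: ler_cvg_to h2 h1 _; apply: nearW => M; apply: h.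
by apply: avg_01 => z; exact: hit_within_01.
Qed.

Lemma hit_io_lower (psi : R -> R) o x : continuous psi ->
  (forall t, 0 <= t <= 1 -> psi t <= pgfc p t) ->
  psi (avg g (hit_io g o) x) <= hit_io g o x.
Proof.
move=> cpsi h; have [h1 h2] := hit_after_pgfc o x cpsi.
by apply: ler_cvg_to h1 h2 _; apply: nearW => N; exact: hit_after_lower.
Qed.

Lemma hit_io_upper (psi : R -> R) o x : continuous psi ->
  (forall t, 0 <= t <= 1 -> pgfc p t <= psi t) ->
  hit_io g o x <= psi (avg g (hit_io g o) x).
Proof.
move=> cpsi h; have [h1 h2] := hit_after_pgfc o x cpsi.
by apply: ler_cvg_to h2 h1 _; apply: nearW => N; exact: hit_after_upper.
Qed.

End FixedGraph.
End HittingProbabilities.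

(** * Spectral radius and transience *)

Section SpectralRadius.
Variables (R : realType) (D : nat) (g : graph).
Hypothesis bg : bdd_graph D g.

Lemma srw_nS n x y : srw_n R g n.+1 x y = avg g (fun z => srw_n R g n z y) x.
Proof. by []. Qed.

Lemma srw_n_01 n x y : 0 <= srw_n R g n x y <= 1.
Proof.
elim: n x => [|n ih] x; last by rewrite srw_nS avg_01.
by rewrite /=; case: eqP; rewrite ?lexx ?ler01.
Qed.

Lemma srw_n_ge0 n x y : 0 <= srw_n R g n x y.
Proof. by case/andP: (srw_n_01 n x y). Qed.

Lemma srw_n_mul m n x z y :
  srw_n R g m x z * srw_n R g n z y <= srw_n R g (m + n) x y.
Proof.
elim: m x => [|m ih] x.
  by rewrite add0n /=; case: eqP => [->|_]; rewrite ?mul1r// mul0r srw_n_ge0.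
rewrite addSn !srw_nS mulrC -avgZ; apply: avg_homo => w.
by rewrite mulrC.
Qed.

Lemma srw_n_expn m k x : srw_n R g m x x ^+ k <= srw_n R g (m * k) x x.
Proof.
elim: k => [|k ih]; first by rewrite expr0 muln0 /= eqxx.
rewrite exprS mulnS; apply: le_trans (srw_n_mul _ _ _ x _).
by rewrite ler_wpM2l ?srw_n_ge0.
Qed.

Lemma srw_1 x y : srw_n R g 1 x y = srw R g x y.
Proof.
rewrite srw_nS /avg /=; have [yx|yx] := boolP (y \in g x).
  rewrite (bigD1_seq y)//= ?(bdd_graph_uniq bg)// eqxx mulr1 big1 ?addr0// => z.
  by move=> /negbTE ->; rewrite mulr0.
rewrite big_seq big1 => [|z zx]; first by rewrite /srw (negbTE yx).
by have [zy|_] := eqVneq z y; [rewrite zy (negbTE yx) in zx|rewrite mulr0].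
Qed.

Lemma srw_n_reach x y : exists n, 0 < srw_n R g n x y.
Proof.
pose Q b := exists n, 0 < srw_n R g n x b.
apply: (bdd_graph_ind (Q := Q) bg (x := x)) => [a b ba [n xa]|].
  exists (n + 1)%N; apply: lt_le_trans (srw_n_mul n 1 x a b).
  by rewrite mulr_gt0// srw_1 srw_gt0.
by exists 0%N; rewrite /= eqxx.
Qed.

Let root n : R := srw_n R g n 0%N 0%N `^ (n%:R^-1).

Let root_01 n : 0 <= root n <= 1.
Proof.
rewrite powR_ge0/=; have /andP[a b] := srw_n_01 n 0 0.
have -> : (1 : R) = 1 `^ (n%:R^-1) by rewrite powR1.
apply: ge0_ler_powR; rewrite ?nnegrE//.
Qed.

Let rootX n : (0 < n)%N -> root n ^+ n = srw_n R g n 0%N 0%N.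
Proof.
move=> n0; rewrite -powR_mulrn ?powR_ge0// -powRrM mulVf ?powRr1 ?srw_n_ge0//.
by rewrite pnatr_eq0 -lt0n.
Qed.

Let rhoE : rho R g = inf (range (sups root)).
Proof.
apply: cvg_lim; first exact: Rhausdorff.
apply: (@cvg_sups_inf R root).
  by exists 1 => _ [n _ <-]; case/andP: (root_01 n).
by exists 0 => _ [n _ <-]; case/andP: (root_01 n).
Qed.

Let sups_ge n k : (n <= k)%N -> root k <= sups root n.
Proof.
move=> nk; apply: ub_le_sup; last by exists k.
by exists 1 => _ [m _ <-]; case/andP: (root_01 m).
Qed.

Let sups_lb : has_lbound (range (sups root)).
Proof.
exists 0 => _ [n _ <-]; apply: le_trans (sups_ge (leqnn n)).
by case/andP: (root_01 n).
Qed.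

Lemma rho_lt_bound r : rho R g < r ->
  exists n0, forall n, (n0 <= n)%N -> srw_n R g n 0%N 0%N <= r ^+ n.
Proof.
rewrite rhoE => /(inf_lt (range_nonempty _))[_ [n0 _ <-]] h.
(* The successor keeps [n] positive, as [rootX] demands. *)
exists n0.+1 => n nn; rewrite -rootX; last by apply: leq_trans nn.
have rr : root n <= r by apply: le_trans (ltW h); apply/sups_ge/ltnW.
by rewrite lerXn2r// nnegrE; [|apply: le_trans rr]; case/andP: (root_01 n).
Qed.

Lemma lt_rho_bound r : 0 <= r -> r < rho R g ->
  exists2 n, (0 < n)%N & r ^+ n < srw_n R g n 0%N 0%N.
Proof.
move=> r0; rewrite rhoE => h.
(* The supremum over indices from 1 on yields a positive [n]. *)
have h1 : r < sups root 1 by apply: lt_le_trans h _; apply: ge_inf => //; exists 1%N.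
have ne : sdrop root 1 !=set0 by exists (root 1), 1%N => /=.
have [_ [n /= n1 <-] rn] := sup_gt ne h1.
by exists n => //; rewrite -rootX// ltrXn2r// ?nnegrE// -lt0n.
Qed.

Lemma rho_le1 : rho R g <= 1.
Proof.
rewrite rhoE; apply: (@le_trans _ _ (sups root 0)).
  by apply: ge_inf => //; exists 0%N.
apply: ge_sup; first by exists (root 0), 0%N => /=.
by move=> _ [n _ <-]; case/andP: (root_01 n).
Qed.

(** Stepping to a neighbour and back gives [c > 0] at time 2, hence at least [c ^ k] at time
    [2 * k]; the roots at even times stay above the square root of [c]. *)
Lemma rho_gt0 : 0 < rho R g.
Proof.
have [y yx] : exists y, y \in g 0%N.
  by have := deg_gt0 bg 0; case: (g 0%N) => // a l _; exists a; rewrite inE eqxx.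
have c0 : 0 < srw_n R g 2 0%N 0%N.
  apply: lt_le_trans (srw_n_mul 1 1 0%N y 0%N); rewrite !srw_1.
  by rewrite mulr_gt0 ?srw_gt0// (bdd_graph_sym bg).
set c := srw_n R g 2 0%N 0%N in c0.
rewrite rhoE; apply: (@lt_le_trans _ _ (c `^ (2^-1))); first by rewrite powR_gt0.
apply: lb_le_inf; first exact: range_nonempty.
move=> _ [n _ <-]; apply: (@le_trans _ _ (root (2 * n.+1))); last first.
  by apply: sups_ge; rewrite mul2n -addnn addSn leqW// leq_addr.
have -> : c `^ 2^-1 = (c ^+ n.+1) `^ ((2 * n.+1)%:R^-1).
  rewrite -powR_mulrn ?(ltW c0)// -powRrM natrM invfM mulrCA mulfV ?mulr1//.
apply: ge0_ler_powR; rewrite ?nnegrE ?invr_ge0 ?srw_n_ge0 ?exprn_ge0 ?(ltW c0)//.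
exact: srw_n_expn.
Qed.

End SpectralRadius.

(** * Green functions and first-passage weights *)

Section Green.
Variables (R : realType) (g : graph) (o : nat).

Fixpoint green (z : R) (N x : nat) : R :=
  if N is N'.+1 then (x == o)%:R + z * avg g (green z N') x else 0.

(* Weights of the paths of length at most [M] that stop at their first visit
   to [o]. *)
Fixpoint first_passage (z : R) (M x : nat) : R :=
  if M is M'.+1 then
    if x == o then 1 else z * avg g (first_passage z M') x
  else (x == o)%:R.

Variable z : R.
Hypothesis z0 : 0 < z.

Lemma greenE N x : green z N x = \sum_(0 <= n < N) z ^+ n * srw_n R g n x o.
Proof.
elim: N x => [|N ih] x; first by rewrite big_geq.
rewrite big_nat_recl//= expr0 mul1r; congr (_ + _).
have E w : z * green z N w = \sum_(0 <= n < N) z ^+ n.+1 * srw_n R g n w o.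
  by rewrite ih mulr_sumr; apply: eq_bigr => n _; rewrite exprS mulrA.
rewrite -avgZ (eq_avg g _ E) /avg; under eq_bigr do rewrite mulr_sumr.
rewrite exchange_big/=; apply: eq_bigr => n _; rewrite mulr_sumr.
by apply: eq_bigr => w _; rewrite mulrCA.
Qed.

Lemma green_homo x : {homo (fun N => green z N x) : N N' / (N <= N')%N >-> N <= N'}.
Proof.
apply: homo_leq => [y|a b c|N]; [exact: lexx|exact: le_trans|].
rewrite !greenE big_nat_recr//= lerDl mulr_ge0 ?srw_n_ge0// exprn_ge0//.
exact: ltW.
Qed.

Lemma first_passage_ge0 M x : 0 <= first_passage z M x.
Proof.
elim: M x => [|M ih] x /=; first by [].
by case: eqP => _; rewrite ?ler01// mulr_ge0 ?(ltW z0)// avg_ge0.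
Qed.

(** A path stopped at its first visit to [o], followed by a loop at [o] of length less than [N], is
    a path to [o] of length less than [N + M], and the pair can be recovered from it. *)
Lemma renewal M N x : first_passage z M x * green z N o <= green z (N + M) x.
Proof.
have G0 n w : 0 <= green z n w by apply: le_trans (green_homo w (leq0n n)).
elim: M x => [|M ih] x /=.
  by rewrite addn0; case: eqP => [->|_]; rewrite ?mul1r ?mul0r.
case: eqP => [->|_]; first by rewrite mul1r; apply: green_homo; rewrite leq_addr.
rewrite addnS /=.
apply: (@le_trans _ _ (z * avg g (green z (N + M)) x)); last by rewrite lerDr.
rewrite -mulrA ler_pM2l// mulrC -avgZ; apply: avg_homo => w; by rewrite mulrC.
Qed.

(** Put one step from [o] in front of [renewal] and let [s] be the supremum of the truncated Green
    functions. Then [a * s <= s - 1], which excludes [a > 1]. *)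
Lemma first_passage_return M C : (forall N, green z N o <= C) ->
  z * avg g (first_passage z M) o <= 1.
Proof.
move=> GC; set a := z * _.
have aG N : a * green z N o <= green z (N + M).+1 o - 1.
  rewrite /= eqxx addrC addKr /a -mulrA ler_pM2l// mulrC -avgZ.
  by apply: avg_homo => w; rewrite mulrC renewal.
rewrite leNgt; apply/negP => a1.
pose s := sup (range (fun N => green z N o)).
have Gs N : green z N o <= s by apply: ub_le_sup; [exists C => _ [n _ <-]|exists N].
have s1 : 1 <= s.
  apply: le_trans (Gs 1%N); rewrite /= eqxx lerDl mulr_ge0 ?(ltW z0)//.
  exact: avg_ge0.
have : s <= (s - 1) / a.
  apply: ge_sup; first exact: range_nonempty.
  move=> _ [N _ <-]; rewrite ler_pdivlMr ?(lt_trans ltr01)// mulrC.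
  by apply: le_trans (aG N) _; rewrite lerD2r.
rewrite ler_pdivlMr ?(lt_trans ltr01)//; nra.
Qed.

End Green.

(** * Transience, criticality included *)

Section Transience.
Variables (R : realType) (p : nat -> R) (D : nat) (g : graph) (o : nat) (z : R).
Hypotheses (hp : offspring p) (bg : bdd_graph D g) (z0 : 0 < z).
Hypothesis mz : (mean p <= z%:E)%E.
Hypothesis green_bounded :
  forall y, 0 < y < z -> exists C, forall N, green g o y N o <= C.

(** The paths counted have length at most [M], so each weight shrinks at most by [l ^ M]. *)
Lemma first_passage_scale l M x : 0 <= l <= 1 ->
  l ^+ M * first_passage g o z M x <= first_passage g o (l * z) M x.
Proof.
move=> /andP[l0 l1]; elim: M x => [|M ih] x /=; first by rewrite expr0 mul1r.
case: eqP => _; first by rewrite mulr1 exprn_ile1.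
rewrite exprS mulrACA ler_wpM2l ?mulr_ge0 ?(ltW z0)// -avgZ.
exact: avg_homo.
Qed.

(** At [z] itself the Green function may diverge, but for fixed [M] the left side is a polynomial in
    [z]; the bound passes to [z] from smaller arguments. *)
Lemma first_passage_critical M : z * avg g (first_passage g o z M) o <= 1.
Proof.
set a := z * _; rewrite leNgt; apply/negP => a1.
have a0 : 0 < a by lra.
(* By Bernoulli, [(1 - e) ^ M.+1 * a >= a - (a - 1) / 2], which still exceeds 1. *)
pose e := (a - 1) / (2 * a * M.+1%:R).
have e0 : 0 < e.
  apply: divr_gt0; first by rewrite subr_gt0.
  by apply: mulr_gt0; [apply: mulr_gt0|rewrite ltr0n].
have aMe : a * (M.+1%:R * e) = (a - 1) / 2.
  have K0 : M.+1%:R != 0 :> R by rewrite pnatr_eq0.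
  have a00 : a != 0 by rewrite gt_eqF.
  by rewrite /e; move: (M.+1%:R) K0 => K K0; field; rewrite a00 K0.
have M1 : 1 <= M.+1%:R :> R by rewrite ler1n.
have Ke1 : M.+1%:R * e < 1 by rewrite -(ltr_pM2l a0) aMe; lra.
have e1 : e < 1 by nra.
have y0 : 0 < (1 - e) * z by rewrite mulr_gt0// subr_gt0.
have yz : (1 - e) * z < z by rewrite gtr_pMl//; lra.
have [C hC] := @green_bounded ((1 - e) * z) ltac:(by rewrite y0 yz).
have := @first_passage_return R g o ((1 - e) * z) y0 M C hC.
have : (1 - e) ^+ M.+1 * a <= (1 - e) * z * avg g (first_passage g o ((1 - e) * z) M) o.
  rewrite exprS /a mulrACA ler_pM2l// -avgZ.
  apply: avg_homo => w; apply: first_passage_scale; lra.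
have : (1 - M.+1%:R * e) * a <= (1 - e) ^+ M.+1 * a.
  by rewrite ler_wpM2r ?(ltW a0)// bernoulli_ineq// !ltW.
nra.
Qed.

Lemma avg_first_passage M x :
  z * avg g (first_passage g o z M) x <= first_passage g o z M.+1 x.
Proof. by rewrite /=; case: eqP => [->|//]; exact: first_passage_critical. Qed.

Lemma first_passage_homo x :
  {homo (fun M => first_passage g o z M x) : M M' / (M <= M')%N >-> M <= M'}.
Proof.
apply: homo_leq => [y|a b c|M]; [exact: lexx|exact: le_trans|].
elim: M x => [|M ih] x /=; case: eqP => _ //.
  by rewrite mulr_ge0 ?(ltW z0)// avg_ge0// => w; rewrite first_passage_ge0.
by rewrite ler_pM2l//; apply: avg_homo.
Qed.

(** Harnack argument: superharmonicity at [a] bounds the value at a neighbour [b] by that at [a]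
    over [z * srw R g a b]. Start from the value at most 1 at [o]. *)
Lemma first_passage_bounded x : exists C, forall M, first_passage g o z M x <= C.
Proof.
pose Q b := exists C, forall M, first_passage g o z M b <= C.
apply: (bdd_graph_ind (Q := Q) bg (x := o)) => [a b ba [C hC]|]; last first.
  by exists 1 => -[|M] /=; rewrite eqxx.
have sab := srw_gt0 R ba.
exists (C / (z * srw R g a b)) => M.
rewrite ler_pdivlMr ?mulr_gt0//; apply: le_trans (hC M.+1).
apply: le_trans (avg_first_passage M a); rewrite mulrC -mulrA ler_pM2l//.
by apply: avg_ge_term => // w; rewrite first_passage_ge0.
Qed.

Let W x : R := sup (range (fun M => first_passage g o z M x)).

Let W_ub x : has_ubound (range (fun M => first_passage g o z M x)).
Proof. by have [C hC] := first_passage_bounded x; exists C => _ [M _ <-]. Qed.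

Let W_ge M x : first_passage g o z M x <= W x.
Proof. by apply: ub_le_sup; [exact: W_ub|exists M]. Qed.

Let W_cvg x : first_passage g o z M x @[M --> \oo] --> W x.
Proof. by apply: nondecreasing_cvgn; [exact: first_passage_homo|exact: W_ub]. Qed.

Let avg_W_cvg x : z * avg g (first_passage g o z M) x @[M --> \oo] --> z * avg g W x.
Proof. by apply: cvgM; [exact: cvg_cst|apply: avg_cvg => w; exact: W_cvg]. Qed.

Let W_super x : z * avg g W x <= W x.
Proof.
apply: ler_cvg_to (@avg_W_cvg x) (cvg_cst (W x)) _; apply: nearW => M.
exact: le_trans (avg_first_passage M x) (W_ge _ _).
Qed.

Let W_return : z * avg g W o <= 1.
Proof.
apply: ler_cvg_to (@avg_W_cvg o) (cvg_cst (1 : R)) _; apply: nearW => M.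
exact: first_passage_critical.
Qed.

Let pgfc_linear t : 0 <= t <= 1 -> pgfc p t <= z * t.
Proof.
move=> t01; apply: le_trans (pgfc_le hp t01 mz) _.
by rewrite lerBlDr lerDl mulr_ge0 ?exprn_ge0//; case: hp => _ _ _; lra.
Qed.

(** By [pgfc_linear], [hit] obeys the recursion of [first_passage] as an inequality. *)
Let hit_le_first_passage M x : hit p g o M x <= first_passage g o z M x.
Proof.
elim: M x => [|M ih] x //=; case: eqP => // _.
apply: le_trans (pgfc_linear _) _; first by apply: avg_01 => w; exact: hit_01.
by rewrite ler_pM2l//; exact: avg_homo.
Qed.

Let hit_io_le_W x : hit_io p g o x <= W x.
Proof.
apply: le_trans (hit_io_le hp g o 0 x) _; apply: hit_after_le => M.
exact: le_trans (hit_le_first_passage M x) (W_ge _ _).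
Qed.

Let hit_io_sub x : hit_io p g o x <= z * avg g (hit_io p g o) x.
Proof.
apply: (@hit_io_upper _ _ hp g (fun t => z * t) o _) pgfc_linear.
by move=> t; apply: continuousM => //; exact: cst_continuous.
Qed.

(* Strong Markov property at the first visit to [o]; the second summand
   bounds the particles that have not reached [o] by generation [M]. *)
Let hit_io_first_passage M x : hit_io p g o x <=
  hit_io p g o o * first_passage g o z M x + (W x - first_passage g o z M x).
Proof.
elim: M x => [|M ih] x /=; have [->|xo] := eqVneq x o.
- by rewrite mulr1 lerDl subr_ge0; have := W_ge 0 o; rewrite /= eqxx.
- by rewrite mulr0 add0r subr0.
- by rewrite mulr1 lerDl subr_ge0; have := W_ge 0 o; rewrite /= eqxx.
apply: le_trans (hit_io_sub x) _.
apply: (@le_trans _ _ (z * avg g (fun w => hit_io p g o o * first_passage g o z M w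
    + (W w - first_passage g o z M w)) x)).
  by rewrite ler_pM2l//; apply: avg_homo.
rewrite avgD avgZ avgB.
by have := W_super x; lra.
Qed.

(** Branching gives [s o <= z * A - c * A ^ 2], while [s <= s o * W] and [W_return] give
    [z * A <= s o]. Hence [c * A ^ 2 <= 0]. *)
Lemma hit_io_eq0 : hit_io p g o o = 0.
Proof.
set s := hit_io p g o.
have sW x : s x <= s o * W x.
  have h : s o * first_passage g o z M x + (W x - first_passage g o z M x)
     @[M --> \oo] --> s o * W x + (W x - W x).
    apply: cvgD; first by apply: cvgM; [exact: cvg_cst|exact: W_cvg].
    by apply: cvgB; [exact: cvg_cst|exact: W_cvg].
  rewrite subrr addr0 in h.
  apply: ler_cvg_to (cvg_cst (s x)) h _; apply: nearW => M.
  exact: hit_io_first_passage.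
have s0 x : 0 <= s x by case/andP: (hit_io_01 hp g o x).
pose c := 1 - p 1%N; have c0 : 0 < c by rewrite subr_gt0; case: hp.
set A := avg g s o.
have A0 : 0 <= A by exact: avg_ge0.
have h1 : s o <= z * A - c * A ^+ 2.
  apply: (@hit_io_upper _ _ hp g (fun t => z * t - c * t ^+ 2) o _) => [t|t t01].
    apply: continuousB; apply: continuousM; try exact: cst_continuous.
      by [].
    exact: exprn_continuous.
  exact: pgfc_le.
have h2 : z * A <= s o.
  apply: (@le_trans _ _ (s o * (z * avg g W o))); last by rewrite ler_piMr.
  by rewrite mulrCA ler_pM2l// -avgZ; apply: avg_homo.
have A00 : A = 0.
  apply/eqP; rewrite -sqrf_eq0 eq_le exprn_ge0// andbT.
  by rewrite -(pmulr_rle0 _ c0); lra.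
by apply/eqP; rewrite eq_le s0 andbT; move: h1; rewrite A00 expr2; lra.
Qed.

End Transience.

Lemma hit_io_transient (R : realType) (p : nat -> R) (D : nat) (g : graph) o :
  offspring p -> bdd_graph D g -> (mean p <= (rho R g)^-1%:E)%E ->
  hit_io p g o o = 0.
Proof.
move=> hp bg mz.
have r0 := rho_gt0 R bg.
apply: (hit_io_eq0 hp bg _ mz); first by rewrite invr_gt0.
move=> y /andP[y0 yr].
have ry : rho R g < y^-1 by rewrite -[ltLHS]invrK ltf_pV2// posrE invr_gt0.
(* Above [rho], so that return probabilities are eventually below [r ^ n], and below [y^-1], so that
   [y * r < 1]. *)
pose r := (rho R g + y^-1) / 2.
have rr : rho R g < r by rewrite /r; lra.
have r00 : 0 < r by lra.
have yr1 : y * r < 1.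
  have : y * r < y * y^-1 by rewrite ltr_pM2l// /r; lra.
  by rewrite mulfV ?gt_eqF//.
have [n0 hn] := rho_lt_bound rr.
have [a ha] := srw_n_reach R bg 0 o.
have [b hb] := srw_n_reach R bg o 0.
set pa := srw_n _ _ _ _ _ in ha; set pb := srw_n _ _ _ _ _ in hb.
(* Cost of comparing loops at [o] with loops at 0: walk from 0 to [o] in [a] steps and back in
   [b]. *)
pose c := r ^+ (a + b) / (pa * pb).
have c0 : 0 <= c.
  by apply: divr_ge0; [exact/exprn_ge0/ltW|exact/ltW/mulr_gt0].
have bound n : (n0 <= n)%N -> y ^+ n * srw_n R g n o o <= c * (y * r) ^+ n.
  move=> nn; rewrite exprMn mulrCA ler_pM2l ?exprn_gt0// /c mulrAC.
  rewrite ler_pdivlMr ?mulr_gt0//.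
  apply: (@le_trans _ _ (srw_n R g (a + n + b) 0%N 0%N)).
    apply: (@le_trans _ _ (srw_n R g (a + n) 0%N o * pb)); last exact: srw_n_mul.
    by rewrite mulrA ler_pM2r// mulrC; exact: srw_n_mul.
  apply: le_trans (hn _ _) _; first by rewrite addnAC; apply: leq_trans nn (leq_addl _ _).
  by rewrite addnAC exprD.
pose q := y * r; have q0 : 0 < q by rewrite mulr_gt0.
have geo N : \sum_(0 <= n < N) q ^+ n <= (1 - q)^-1.
  rewrite -[leRHS]mul1r ler_pdivlMr ?subr_gt0//.
  suff -> : (\sum_(0 <= n < N) q ^+ n) * (1 - q) = 1 - q ^+ N.
    by rewrite gerBl exprn_ge0// ltW.
  elim: N => [|N ih]; first by rewrite big_geq// expr0 subrr mul0r.
  by rewrite big_nat_recr//= mulrDl ih exprS; ring.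
exists (\sum_(0 <= n < n0) y ^+ n * srw_n R g n o o + c * (1 - q)^-1) => N.
apply: le_trans (green_homo g o y0 o (leq_addl n0 N)) _.
rewrite greenE (@big_cat_nat _ _ _ n0)//= ?leq_addr// lerD2l.
apply: (@le_trans _ _ (\sum_(n0 <= n < n0 + N) c * q ^+ n)).
  by rewrite !big_nat; apply: ler_sum => n /andP[nn _]; exact: bound.
rewrite -mulr_sumr ler_wpM2l//; apply: le_trans (geo (n0 + N)%N).
rewrite [leRHS](@big_cat_nat _ _ _ n0)//= ?leq_addr// lerDr.
by apply: sumr_ge0 => n _; rewrite exprn_ge0// ltW.
Qed.

(** * Supercritical case *)

Section Supercritical.
Variables (R : realType) (p : nat -> R) (D : nat) (g : graph).
Hypotheses (hp : offspring p) (bg : bdd_graph D g).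

Let pgfc_ge_id t : 0 <= t <= 1 -> t <= pgfc p t.
Proof.
move=> t01; apply: le_trans (pgfc_ge hp t01); have /andP[t0 t1] := t01.
by rewrite lerDl !mulr_ge0// subr_ge0//; case: hp => _ _ _; exact: ltW.
Qed.

Lemma hit_after_gt0 o x : 0 < hit_after p g o 0 x.
Proof.
pose Q b := exists M, 0 < hit p g o M b.
suff [M hM] : Q x by apply: lt_le_trans hM _; exact: (hit_within_le hp g o 0 M x).
apply: (bdd_graph_ind (Q := Q) bg (x := o)) => [a b ba [M hM]|]; last first.
  by exists 0%N; rewrite /= eqxx.
exists M.+1; rewrite /=; case: eqP => // _.
have h01 z : 0 <= hit p g o M z <= 1 by exact: hit_01.
apply: lt_le_trans (pgfc_ge_id (avg_01 g b h01)).
apply: (@lt_le_trans _ _ (srw R g b a * hit p g o M a)).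
  by rewrite mulr_gt0// srw_gt0// (bdd_graph_sym bg).
apply: avg_ge_term; last by rewrite (bdd_graph_sym bg).
by move=> z; case/andP: (h01 z).
Qed.

Section Survival.
Variables (a eta : R) (n : nat).
Hypotheses (a1 : 1 <= a) (eta0 : 0 < eta).
Hypothesis a_eta : forall t, 0 <= t <= eta -> a * t <= pgfc p t.
Hypothesis an : 1 < a ^+ n * srw_n R g n 0%N 0%N.

(** A continuous minorant of [pgfc p] on [0, 1], fit for [hit_after_lower]: the linear bound, frozen
    beyond [eta]. *)
Let psi (t : R) : R := a * Num.min t eta.

Let psi_continuous : continuous psi.
Proof.
rewrite /psi => t; apply: cvgM; first exact: cvg_cst.
by apply: (@continuous_min R R idfun (cst eta)); [|exact: cst_continuous].
Qed.

Let psi_le t : 0 <= t <= 1 -> psi t <= pgfc p t.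
Proof.
move=> /andP[t0 t1]; rewrite /psi /Num.min; case: ltP => [te|et].
  by apply: a_eta; rewrite t0 ltW.
apply: le_trans (pgfc_homo hp (ltW eta0) et t1).
by apply: a_eta; rewrite lexx ltW.
Qed.

(* The embedded process of descendants at the root in generations [n], [2n], ...
   has mean [a ^+ n * srw_n R g n 0 0 > 1]. *)
Let growth (f : nat -> nat -> R) N (tau : R) :
  (forall k y, 0 <= f k y) ->
  (forall k y, psi (avg g (f k) y) <= f k.+1 y) ->
  0 <= tau -> tau * a ^+ n <= eta -> tau <= f N 0%N ->
  tau * (a ^+ n * srw_n R g n 0%N 0%N) <= f (N + n)%N 0%N.
Proof.
move=> f0 fS tau0 taun tauf.
(* Up to generation [n] the lower bound stays below [eta], so the truncation in [psi] never acts. *)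
suff h j y : (j <= n)%N ->
    tau * (a ^+ j * srw_n R g j y 0%N) <= f (N + j)%N y by exact: h.
elim: j y => [|j ih] y jn.
  by rewrite /= expr0 mul1r addn0; case: eqP => [->|_]; rewrite ?mulr1// mulr0.
rewrite addnS; apply: le_trans (fS _ _).
have a0 : 0 <= a by exact: le_trans ler01 a1.
have hA : tau * a ^+ j * srw_n R g j.+1 y 0%N <= avg g (f (N + j)%N) y.
  rewrite srw_nS -avgZ; apply: avg_homo => w; rewrite -mulrA; apply: ih.
  exact: ltnW.
have hE : tau * a ^+ j * srw_n R g j.+1 y 0%N <= eta.
  apply: le_trans taun; apply: (@le_trans _ _ (tau * a ^+ j)).
    by rewrite ler_piMr ?mulr_ge0 ?exprn_ge0//; case/andP: (srw_n_01 R g j.+1 y 0).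
  by rewrite ler_wpM2l// ler_weXn2l// ltnW.
have -> : tau * (a ^+ j.+1 * srw_n R g j.+1 y 0%N) =
    a * (tau * a ^+ j * srw_n R g j.+1 y 0%N).
  by rewrite exprS; ring.
rewrite /psi ler_wpM2l//.
by rewrite le_min hA hE.
Qed.

(** Largest starting value for which [n] generations remain in the linear regime; it does not depend
    on the target. *)
Let delta : R := eta / a ^+ n.

Let delta0 : 0 < delta.
Proof. by rewrite divr_gt0// exprn_gt0// (lt_le_trans ltr01). Qed.

Let delta_le tau : (tau <= delta) = (tau * a ^+ n <= eta).
Proof. by rewrite /delta ler_pdivlMr// exprn_gt0// (lt_le_trans ltr01). Qed.

Let n_gt0 : (0 < n)%N.
Proof. by move: an; case: n => // ; rewrite /= expr0 mulr1 ltxx. Qed.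

(** A level [tau <= delta] reached at some generation is reached again [n] generations later, as the
    growth factor exceeds 1. This [tau] still depends on [o]. *)
Let hit_io_gt0 o : 0 < hit_io p g o 0%N.
Proof.
pose f := hit_after p g o.
have f0 k y : 0 <= f k y by case/andP: (hit_after_01 hp g o k y).
have fS k y : psi (avg g (f k) y) <= f k.+1 y.
  exact: (hit_after_lower hp).
pose tau := Num.min (f 0%N 0%N) delta.
have tau0 : 0 < tau by rewrite lt_min delta0 andbT; exact: hit_after_gt0.
have tau_n : tau * a ^+ n <= eta by rewrite -delta_le ge_min lexx orbT.
have h k : tau <= f (k * n)%N 0%N.
  elim: k => [|k ih]; first by rewrite mul0n ge_min lexx.
  rewrite mulSn addnC; apply: le_trans (growth f0 fS (ltW tau0) tau_n ih).
  by rewrite ler_peMr ?ltW.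
apply: lt_le_trans tau0 _; apply: hit_io_ge => N; apply: le_trans (h N) _.
by apply: hit_after_homo => //; rewrite leq_pmulr.
Qed.

(** Were the value below [delta], [growth] applied to the constant sequence [hit_io] would multiply
    it by a factor above 1 and yet bound it by itself. Positivity thus becomes uniform in [o]. *)
Lemma hit_io_ge_survival o : delta <= hit_io p g o 0%N.
Proof.
rewrite leNgt; apply/negP => /ltW h.
have s0 := hit_io_gt0 o.
have : hit_io p g o 0%N * (a ^+ n * srw_n R g n 0%N 0%N) <= hit_io p g o 0%N.
  apply: (@growth (fun=> hit_io p g o) 0) => //; last 1 first.
  - by rewrite -delta_le.
  - by move=> _ y; case/andP: (hit_io_01 hp g o y).
  - by move=> _ y; exact: (hit_io_lower hp).
  - exact: ltW.
by rewrite leNgt ltr_pMr// an.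
Qed.

End Survival.

Lemma hit_all_supercritical : ((rho R g)^-1%:E < mean p)%E -> 0 < hit_all p g 0%N.
Proof.
move=> rm; have r0 := rho_gt0 R bg.
(* A finite slope strictly between [1 / rho] and the mean, which may be infinite. *)
have [a ra am] : exists2 a : R, (rho R g)^-1 < a & (a%:E < mean p)%E.
  case: (mean p) rm => [m| |//]; last by exists ((rho R g)^-1 + 1); rewrite ?ltry ?ltrDl.
  rewrite lte_fin => h; exists (((rho R g)^-1 + m) / 2); rewrite ?lte_fin; lra.
have ir1 : 1 <= (rho R g)^-1 by rewrite invf_ge1// rho_le1.
have a0 : 0 < a by lra.
have [n n0 hn] : exists2 n, (0 < n)%N & a^-1 ^+ n < srw_n R g n 0%N 0%N.
  apply: lt_rho_bound; first by rewrite invr_ge0 ltW.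
  by rewrite -[ltRHS]invrK ltf_pV2// posrE invr_gt0.
have [eta e0 he] := pgfc_ge_mean hp am.
have an : 1 < a ^+ n * srw_n R g n 0%N 0%N.
  by rewrite -ltr_pdivrMl ?exprn_gt0// mulr1 -exprVn.
have := @hit_io_ge_survival a eta n ltac:(lra) e0 he an => h.
by apply: lt_le_trans (hit_all_ge h); rewrite divr_gt0// exprn_gt0.
Qed.

(** The map [t + c * (t * (1 - t))] is nondecreasing on [0, 1] because [c <= 1], so the bound for
    each target survives the infimum. *)
Lemma hit_all_super x (v := avg g (hit_all p g) x) :
  v + (1 - p 1%N) * (v * (1 - v)) <= hit_all p g x.
Proof.
set c := 1 - p 1%N.
have c0 : 0 <= c by rewrite subr_ge0; case: hp => _ _ _ /ltW.
have c1 : c <= 1 by rewrite gerBl; case: hp.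
apply: hit_all_ge => o; set w := avg g (hit_io p g o) x.
have vw : v <= w by apply: avg_homo => z; exact: hit_all_le.
have v0 : 0 <= v by apply: avg_ge0 => z; case/andP: (hit_all_01 hp g z).
have w1 : w <= 1 by apply: avg_le1 => z; case/andP: (hit_io_01 hp g o z).
have : w + c * (w * (1 - w)) <= hit_io p g o x.
  apply: (@hit_io_lower _ _ hp g (fun t => t + c * (t * (1 - t))) o x);
    last exact: pgfc_ge.
  move=> t; apply: cvgD; first exact: cvg_id.
  apply: cvgM; first exact: cvg_cst.
  by apply: cvgM; [exact: cvg_id|apply: cvgB; [exact: cvg_cst|exact: cvg_id]].
apply: le_trans.
(* This product is the difference of the values of that map at [w] and at [v]. *)
have : 0 <= (w - v) * (1 + c * (1 - v - w)).
  rewrite mulr_ge0 ?subr_ge0//.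
  have : 0 <= c * (2 - v - w) by rewrite mulr_ge0//; lra.
  by lra.
lra.
Qed.

(** For some [p k > 0], [pgfc_le_pow] shows that the value 1 forces the neighbourhood average to be
    1, hence every neighbour's value. *)
Lemma hit_io_eq1 o x y : hit_io p g o x = 1 -> hit_io p g o y = 1.
Proof.
apply: (bdd_graph_ind (Q := fun z => hit_io p g o z = 1) bg) => a b ba ha.
have h01 z : 0 <= hit_io p g o z <= 1 by exact: hit_io_01.
apply: (avg_eq1 bg _ _ ba); first by move=> w; case/andP: (h01 w).
have [k pk] := offspring_pos hp.
have : hit_io p g o a <= 1 - p k * (1 - avg g (hit_io p g o) a) ^+ k.
  apply: (@hit_io_upper _ _ hp g (fun t => 1 - p k * (1 - t) ^+ k) o a) => [t|t t01].
    apply: cvgB; first exact: cvg_cst.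
    apply: cvgM; first exact: cvg_cst.
    apply: (@continuous_comp _ _ _ (fun t : R => 1 - t) (fun t : R => t ^+ k)).
      by apply: cvgB; [exact: cvg_cst|exact: cvg_id].
    exact: exprn_continuous.
  exact: pgfc_le_pow.
rewrite ha => h.
have /andP[v0 v1] := avg_01 g a h01.
apply/eqP; rewrite eq_le v1 leNgt; apply/negP => vlt.
have : 0 < p k * (1 - avg g (hit_io p g o) a) ^+ k.
  by rewrite mulr_gt0// exprn_gt0// subr_gt0.
by lra.
Qed.

End Supercritical.

(** * Mass transport *)

Section IsoInvariance.
Variables (R : realType) (p : nat -> R) (g1 g2 : graph) (s t : nat -> nat).
Hypotheses (sK : cancel s t) (tK : cancel t s).
Hypothesis siso : forall x, perm_eq (map s (g1 x)) (g2 (s x)).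

Let avg_iso (f1 f2 : nat -> R) x : (forall z, f2 (s z) = f1 z) ->
  avg g2 f2 (s x) = avg g1 f1 x.
Proof.
move=> f12; rewrite !avg_mean -(perm_big _ (siso x))/= big_map.
rewrite -(perm_size (siso x)) size_map; congr (_ * _).
by apply: eq_bigr => z _.
Qed.

Let s_eq x y : (s x == s y) = (x == y).
Proof. exact/inj_eq/(can_inj sK). Qed.

Let hit_iso o M x : hit p g2 (s o) M (s x) = hit p g1 o M x.
Proof.
elim: M x => [|M ih] x /=; rewrite s_eq//.
by rewrite (@avg_iso (hit p g1 o M))// => z.
Qed.

Let hit_within_iso o N M x :
  hit_within p g2 (s o) N M (s x) = hit_within p g1 o N M x.
Proof.
elim: N x => [|N ih] x /=; first exact: hit_iso.
by rewrite (@avg_iso (hit_within p g1 o N M)).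
Qed.

Let hit_io_iso o x : hit_io p g2 (s o) (s x) = hit_io p g1 o x.
Proof.
rewrite /hit_io; congr inf; apply: eq_imagel => N _.
rewrite /hit_after; congr sup; apply: eq_imagel => M _.
exact: hit_within_iso.
Qed.

(** A relabelling moves the target as well; the infimum over all targets absorbs this. *)
Lemma hit_all_iso x : hit_all p g2 (s x) = hit_all p g1 x.
Proof.
rewrite /hit_all; congr inf; apply/seteqP; split => _ [k _ <-].
  by exists (t k) => //; rewrite -hit_io_iso tK.
by exists (s k) => //; rewrite hit_io_iso.
Qed.

Lemma adj_iso o x : (s x \in g2 (s o)) = (x \in g1 o).
Proof. by rewrite -(perm_mem (siso o)) mem_map//; exact: can_inj sK. Qed.

End IsoInvariance.

(** * Measurability on the space of graphs *)

Section Measurability.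
Variables (R : realType) (p : nat -> R).
Hypothesis hp : offspring p.

Lemma measurable_row (x : nat) (l : seq nat) : measurable [set g : Gr | g x = l].
Proof.
have h : graph_cyl [set g | g x = l] by exists x, l.
exact: (@sub_sigma_algebra _ [set: graph] graph_cyl _ h).
Qed.

(** A row takes countably many values; on each piece it is a fixed list. *)
Lemma measurable_fun_row (h : seq nat -> Gr -> R) x :
  (forall l, measurable_fun [set: Gr] (h l)) ->
  measurable_fun [set: Gr] (fun g : Gr => h (g x) g).
Proof.
move=> mh _ B mB; rewrite setTI.
have -> : (fun g : Gr => h (g x) g) @^-1` B =
    \bigcup_l ([set g : Gr | g x = l] `&` (h l @^-1` B)).
  by apply/seteqP; split => [g Bg|g [l _ [<-]]] //; exists (g x).
apply: countable_bigcupT_measurable => // l; apply: measurableI.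
  exact: measurable_row.
by rewrite -[X in measurable X]setTI; exact: mh.
Qed.

Lemma measurable_avg (f : Gr -> nat -> R) x :
  (forall z, measurable_fun [set: Gr] (f ^~ z)) ->
  measurable_fun [set: Gr] (fun g : Gr => avg g (f g) x).
Proof.
move=> mf; under eq_fun do rewrite avg_mean.
apply: (@measurable_fun_row (fun l g => (size l)%:R^-1 * \sum_(z <- l) f g z)) => l.
by apply: measurable_funM; [exact: measurable_cst|exact: measurable_sum].
Qed.

(* Clamping to [0, 1] makes [pgfc] monotone on the whole line. *)
Lemma measurable_pgfc (f : Gr -> R) : (forall g, 0 <= f g <= 1) ->
  measurable_fun [set: Gr] f -> measurable_fun [set: Gr] (fun g => pgfc p (f g)).
Proof.
move=> f01 mf; pose clamp (t : R) := Num.max 0 (Num.min t 1).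
have -> : (fun g => pgfc p (f g)) = (pgfc p \o clamp) \o f.
  apply/funext => g /=; congr pgfc; have /andP[f0 f1] := f01 g.
  by rewrite /clamp (min_idPl f1) (max_idPr f0).
apply: measurableT_comp => //; apply: nondecreasing_measurable => //.
move=> a b ab /=; apply: pgfc_homo => //.
- by rewrite le_max lexx.
- by rewrite ge_max !le_max lexx/= le_min !ge_min ab lexx !orbT.
- by rewrite ge_max ler01 ge_min lexx orbT.
Qed.

Lemma measurable_hit_within o N M x :
  measurable_fun [set: Gr] (fun g : Gr => hit_within p g o N M x).
Proof.
elim: N x => [|N ih] x /=; last first.
  apply: measurable_pgfc; first by move=> g; apply: avg_01 => z; exact: hit_within_01.
  exact: (@measurable_avg (fun g z => hit_within p g o N M z)).
elim: M x => [|M ih] x /=; first exact: measurable_cst.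
case: eqP => _; first exact: measurable_cst.
apply: measurable_pgfc; first by move=> g; apply: avg_01 => z; exact: hit_01.
exact: (@measurable_avg (fun g z => hit p g o M z)).
Qed.

Lemma sdrop0 (T : Type) (u : nat -> T) : sdrop u 0 = range u.
Proof. by apply/seteqP; split => _ [n _ <-]; exists n. Qed.

Lemma measurable_hit_all x : measurable_fun [set: Gr] (fun g : Gr => hit_all p g x).
Proof.
have inf01 (f : nat -> Gr -> R) : (forall n g, 0 <= f n g <= 1) ->
    (forall n, measurable_fun [set: Gr] (f n)) ->
    measurable_fun [set: Gr] (fun g => inf (range (f ^~ g))).
  move=> f01 mf.
  have -> : (fun g => inf (range (f ^~ g))) = (fun g => infs (f ^~ g) 0).
    by apply/funext => g; rewrite /infs /= sdrop0.
  apply: measurable_fun_infs => // g _.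
  by exists 0 => _ [n _ <-]; case/andP: (f01 n g).
apply: (inf01 _) => [k g|k]; first exact: hit_io_01.
apply: inf01 => [N g|N]; first exact: hit_after_01.
have -> : (fun g => hit_after p g k N x) =
    (fun g => sups ((fun M g => hit_within p g k N M x) ^~ g) 0).
  by apply/funext => g; rewrite /sups /= sdrop0.
apply: measurable_fun_sups => [g _|M]; last exact: measurable_hit_within.
by exists 1 => _ [n _ <-]; case/andP: (hit_within_01 hp g k N n x).
Qed.

End Measurability.

Lemma nneseries_seq (R : realType) (f : nat -> R) (l : seq nat) :
  uniq l -> (forall x, 0 <= f x) ->
  (\sum_(x <oo) (if x \in l then f x else 0)%:E)%E = (\sum_(x <- l) f x)%:E.
Proof.
move=> ul f0; pose n := (\max_(x <- l) x).+1.
have ln x : x \in l -> (x < n)%N by move=> xl; rewrite ltnS; exact: leq_bigmax_seq.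
rewrite (nneseries_split 0 n); last by move=> k _; rewrite lee_fin; case: ifP.
rewrite add0n eseries0 ?adde0; last first.
  move=> k nk _; case: ifP => // /ln; by rewrite ltnNge nk.
rewrite sumEFin; congr (_%:E).
rewrite -big_mkcond/= -big_filter; apply: perm_big; apply: uniq_perm => //.
  by rewrite filter_uniq// iota_uniq.
move=> x; rewrite mem_filter mem_index_iota /=; case xl: (x \in l) => //=.
exact: ln.
Qed.

Lemma ae_imp (R : realType) (nu : probability Gr R) (P Q : Gr -> Prop) :
  (forall g, P g -> Q g) -> {ae nu, forall g, P g} -> {ae nu, forall g, Q g}.
Proof. by move=> h; exact: filterS. Qed.

Lemma ae_imp2 (R : realType) (nu : probability Gr R) (P Q S : Gr -> Prop) :
  (forall g, P g -> Q g -> S g) ->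
  {ae nu, forall g, P g} -> {ae nu, forall g, Q g} -> {ae nu, forall g, S g}.
Proof. by move=> h; exact: filterS2. Qed.

Section MassTransport.
Variables (R : realType) (nu : probability Gr R) (p : nat -> R) (D : nat).
Hypotheses (hp : offspring p) (unu : unimodular nu).
Hypothesis bnu : {ae nu, forall g : Gr, bdd_graph D g}.

Let F (g : graph) (o x : nat) : \bar R :=
  (if x \in g o then hit_all p g o else 0)%:E.

Let F_ge0 g o x : (0 <= F g o x)%E.
Proof. by rewrite lee_fin; case: ifP => // _; case/andP: (hit_all_01 hp g o). Qed.

Let F_meas o x : measurable_fun [set: Gr] (fun g : Gr => F g o x).
Proof.
apply/measurable_EFinP.
apply: (@measurable_fun_row _ (fun l g => if x \in l then hit_all p g o else 0) o) => l.
by case: (x \in l); [exact: measurable_hit_all|exact: measurable_cst].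
Qed.

(** Total mass sent and received by the root when each vertex sends its [hit_all] value to every
    neighbour. *)
Let out (g : Gr) : R := (size (g 0%N))%:R * hit_all p g 0%N.
Let inn (g : Gr) : R := (size (g 0%N))%:R * avg g (hit_all p g) 0%N.

Let m_out : measurable_fun [set: Gr] out.
Proof.
apply: (@measurable_fun_row _ (fun l g => (size l)%:R * hit_all p g 0%N) 0%N) => l.
by apply: measurable_funM; [exact: measurable_cst|exact: measurable_hit_all].
Qed.

Let m_inn : measurable_fun [set: Gr] inn.
Proof.
apply: (@measurable_fun_row _
  (fun l g => (size l)%:R * avg g (hit_all p g) 0%N) 0%N) => l.
apply: measurable_funM; first exact: measurable_cst.
by apply: measurable_avg => z; exact: measurable_hit_all.
Qed.

Let out_ge0 g : 0 <= out g.
Proof. by rewrite mulr_ge0//; case/andP: (hit_all_01 hp g 0). Qed.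

Let inn_ge0 g : 0 <= inn g.
Proof. by rewrite mulr_ge0// avg_ge0// => z; case/andP: (hit_all_01 hp g z). Qed.

Let inn_le_out g : inn g <= out g.
Proof.
rewrite ler_wpM2l//; have /= := hit_all_super g hp 0; apply: le_trans.
have /andP[v0 v1] : 0 <= avg g (hit_all p g) 0%N <= 1.
  by apply: avg_01 => z; exact: hit_all_01.
by rewrite lerDl !mulr_ge0// subr_ge0//; case: hp => _ _ _ /ltW.
Qed.

Let int_out_inn : (\int[nu]_g (out g)%:E = \int[nu]_g (inn g)%:E)%E.
Proof.
have := unu F_ge0 F_meas.
have iF : iso_invariant F.
  move=> g1 g2 s t sK tK siso o x; rewrite /F (adj_iso sK siso).
  by rewrite (hit_all_iso p sK tK siso).
move=> /(_ iF) e.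
have mF (f : nat -> Gr -> \bar R) : (forall k g, (0 <= f k g)%E) ->
    (forall k, measurable_fun [set: Gr] (f k)) ->
    measurable_fun [set: Gr] (fun g => (\sum_(x <oo) f x g)%E).
  by move=> f0 mf; apply: ge0_emeasurable_sum.
transitivity (\int[nu]_(g in [set: Gr]) (\sum_(x <oo) F g 0%N x))%E.
  apply: (ge0_ae_eq_integral measurableT).
  - exact/measurable_EFinP.
  - exact: mF.
  - by move=> g _; rewrite lee_fin.
  - by move=> g _; apply: nneseries_ge0.
  apply: (ae_imp _ bnu) => g bg _.
  rewrite (@nneseries_seq _ (fun=> hit_all p g 0%N)).
  - by rewrite big_const_seq iter_addr_0 count_predT /out mulr_natl.
  - exact: bdd_graph_uniq bg _.
  - by move=> _; case/andP: (hit_all_01 hp g 0).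
rewrite e; apply: (ge0_ae_eq_integral measurableT).
- exact: mF.
- exact/measurable_EFinP.
- by move=> g _; apply: nneseries_ge0.
- by move=> g _; rewrite lee_fin.
apply: (ae_imp _ bnu) => g bg _.
transitivity (\sum_(x <oo) (if x \in g 0%N then hit_all p g x else 0)%:E)%E.
  by apply: eq_eseriesr => x _; rewrite /F (bdd_graph_sym bg).
rewrite nneseries_seq.
- have d0 : (size (g 0%N))%:R != 0 :> R.
    by rewrite pnatr_eq0 -lt0n (deg_gt0 bg).
  by congr (_%:E); rewrite /inn avg_mean mulrA (mulfV d0) mul1r.
- exact: bdd_graph_uniq bg _.
- by move=> x; case/andP: (hit_all_01 hp g x).
Qed.

(** Pointwise [inn <= out], and the integrals agree, so the two are equal almost everywhere; the
    positive degree then cancels. *)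
Lemma hit_all_harmonic :
  {ae nu, forall g : Gr, avg g (hit_all p g) 0%N = hit_all p g 0%N}.
Proof.
pose c g := out g - inn g.
have c0 g : 0 <= c g by rewrite subr_ge0.
have mc : measurable_fun [set: Gr] (EFin \o c).
  by apply/measurable_EFinP; exact: measurable_funB.
(* The bound [D] on the degrees makes the integrals finite, so that they can be subtracted. *)
have fin_inn : (\int[nu]_g (inn g)%:E)%E \is a fin_num.
  rewrite ge0_fin_numE; last by apply: integral_ge0 => g _; rewrite lee_fin.
  apply: (@le_lt_trans _ _ (\int[nu]_(g in [set: Gr]) D%:R%:E)%E); last first.
    by rewrite integral_cst//= probability_setT mule1 ltry.
  apply: (ae_ge0_le_integral measurableT).
  - by move=> g _; rewrite lee_fin.
  - exact/measurable_EFinP.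
  - by move=> g _; rewrite lee_fin.
  - exact: measurable_cst.
  apply: (ae_imp _ bnu) => g bg _; rewrite lee_fin.
  have h : avg g (hit_all p g) 0%N <= 1.
    by apply: avg_le1 => z; case/andP: (hit_all_01 hp g z).
  apply: (@le_trans _ _ ((size (g 0%N))%:R)); first by rewrite /inn ler_piMr.
  by rewrite ler_nat; case: bg.
have ic : (\int[nu]_g (c g)%:E = 0)%E.
  have : (\int[nu]_g (out g)%:E = \int[nu]_g (inn g)%:E + \int[nu]_g (c g)%:E)%E.
    rewrite -ge0_integralD//.
    - by apply: eq_integral => g _; rewrite -EFinD /c subrKC.
    - by move=> g _; rewrite lee_fin.
    - exact/measurable_EFinP.
    - by move=> g _; rewrite lee_fin.
  rewrite int_out_inn => h.
  move: fin_inn h; move: (\int[nu]_g (inn g)%:E)%E (\int[nu]_g (c g)%:E)%E.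
  by move=> [r| |] [s| |] //= _; rewrite -EFinD => -[e]; congr EFin; lra.
have : ae_eq nu [set: Gr] (EFin \o c) (cst 0%E).
  apply/(@ae_eq_integral_abs _ _ _ nu _ measurableT _ mc); rewrite -ic.
  by apply: eq_integral => g _ /=; rewrite ger0_norm.
move=> h; apply: (ae_imp2 _ bnu h) => g bg /(_ Logic.I) /= [] /eqP.
rewrite subr_eq0 /out /inn => /eqP/mulfI -> //.
by rewrite pnatr_eq0 -lt0n (deg_gt0 bg).
Qed.

(** Harmonicity reduces [hit_all_super] to [(1 - p 1) * (v * (1 - v)) <= 0]. *)
Lemma hit_all_01_law :
  {ae nu, forall g : Gr, hit_all p g 0%N = 0 \/ hit_all p g 0%N = 1}.
Proof.
apply: (ae_imp _ hit_all_harmonic) => g h.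
have := hit_all_super g hp 0; rewrite /= h; set v := hit_all p g 0%N.
have /andP[v0 v1] : 0 <= v <= 1 by exact: hit_all_01.
rewrite gerDl pmulr_rle0; last by rewrite subr_gt0; case: hp.
move=> vv; have /eqP : v * (1 - v) = 0.
  by apply/eqP; rewrite eq_le vv mulr_ge0// subr_ge0.
by rewrite mulf_eq0 subr_eq0 => /orP[/eqP|/eqP <-]; [left|right].
Qed.

End MassTransport.

(** * Independence and branching *)

Section BlockIndependence.
Variables (R : realType) (d : measure_display) (Om : measurableType d).
Variables (P : probability Om R) (I : eqType) (Z : I -> Om -> nat).
Hypothesis mZ : forall i, measurable_fun [set: Om] (Z i).
Hypothesis iZ : mutually_independent P Z.
Implicit Types J : pred I.

(** Pi-system generating the sigma-algebra of the variables indexed by [J]. *)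
Definition rect J : set (set Om) :=
  [set E | exists (s : seq I) (A : I -> set nat),
     all J s /\ E = \bigcap_(i in [set` s]) (Z i @^-1` A i)].

Lemma rect_setT J : rect J setT.
Proof.
exists [::], (fun=> setT); split=> //.
by apply/seteqP; split.
Qed.

Lemma rect1 J i (A : set nat) : J i -> rect J (Z i @^-1` A).
Proof.
move=> Ji; exists [:: i], (fun=> A); split; first by rewrite /= Ji.
apply/seteqP; split => [om h k /=|om /(_ i)].
  by rewrite inE => /eqP ->.
by apply; rewrite /= inE.
Qed.

Lemma rect_setI J : setI_closed (rect J).
Proof.
move=> _ _ [s1 [A1 [J1 ->]]] [s2 [A2 [J2 ->]]].
exists (s1 ++ s2), (fun i => [set k | (i \in s1 -> A1 i k) /\ (i \in s2 -> A2 i k)]).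
split; first by rewrite all_cat J1.
apply/seteqP; split => [om [h1 h2] i _ /=|om h].
  by split => [/h1|/h2].
split => i /= si; first by have /= [|+ _] := h i; rewrite ?mem_cat ?si//; apply.
by have /= [|_ +] := h i; rewrite ?mem_cat ?si ?orbT//; apply.
Qed.

Lemma rect_measurable J : rect J `<=` measurable.
Proof.
move=> _ [s [A [_ ->]]]; apply: fin_bigcap_measurable; first exact: finite_seq.
by move=> i _; rewrite -[X in measurable X]setTI; exact: mZ.
Qed.

Lemma sigma_rect_measurable J : <<s rect J >> `<=` measurable.
Proof. exact: (smallest_sub (@sigma_algebra_measurable _ Om) (@rect_measurable J)). Qed.

Lemma sigma_rectS J J' : (forall i, J i -> J' i) -> <<s rect J >> `<=` <<s rect J' >>.
Proof.
move=> JJ'; apply: sub_smallest2r; first exact: smallest_sigma_algebra.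
move=> _ [s [A [Js ->]]]; exists s, A; split=> //.
exact: sub_all Js.
Qed.

Lemma rect_indep J1 J2 E1 E2 : (forall i, J1 i -> ~~ J2 i) ->
  rect J1 E1 -> rect J2 E2 -> P (E1 `&` E2) = (P E1 * P E2)%E.
Proof.
move=> J12 [s1 [A1 [hJ1 ->]]] [s2 [A2 [hJ2 ->]]].
(* Independence is stated for duplicate-free lists. *)
have undE (s : seq I) A : \bigcap_(i in [set` s]) (Z i @^-1` A i) =
    \bigcap_(i in [set` undup s]) (Z i @^-1` A i).
  by apply/seteqP; split => om h i /= si; apply: h; move: si; rewrite /= mem_undup.
rewrite (undE s1) (undE s2).
have dj i : i \in undup s2 -> i \in undup s1 = false.
  rewrite !mem_undup => /(allP hJ2) h2; apply/negbTE/negP => /(allP hJ1)/J12.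
  by rewrite h2.
pose A i := if i \in undup s1 then A1 i else A2 i.
have -> : \bigcap_(i in [set` undup s1]) (Z i @^-1` A1 i) `&`
          \bigcap_(i in [set` undup s2]) (Z i @^-1` A2 i) =
          \bigcap_(i in [set` undup s1 ++ undup s2]) (Z i @^-1` A i).
  apply/seteqP; split => [om [h1 h2] i /=|om h].
    rewrite mem_cat /A; case: ifP => [i1 _|_ /= i2]; first exact: h1.
    exact: h2.
  split => i /= si.
    by have := h i; rewrite /= mem_cat si /A si; apply.
  by have := h i; rewrite /= mem_cat si orbT /A dj//; apply.
rewrite !iZ ?undup_uniq//; last first.
  rewrite cat_uniq !undup_uniq andbT /=; apply/hasPn => i /dj.
  by rewrite /= => ->.
rewrite big_cat /=; congr (_ * _)%E; apply: eq_big_seq => i si.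
  by rewrite /A si.
by rewrite /A dj.
Qed.

(** Two finite measures of [E], namely [P (E & E2)] and [P E2 * P E], agree on a pi-system and hence
    on the sigma-algebra it generates. *)
Let half_indep J E1 E2 : measurable E2 ->
  (forall E, rect J E -> P (E `&` E2) = (P E * P E2)%E) ->
  <<s rect J >> E1 -> P (E1 `&` E2) = (P E1 * P E2)%E.
Proof.
move=> mE2 h sE1.
have f0 : 0 <= fine (P E2) by rewrite fine_ge0.
have fE : (fine (P E2))%:E = P E2 by rewrite fineK// fin_num_measure.
suff : mrestr P mE2 E1 = mscale (NngNum f0) P E1.
  by rewrite /mrestr /mscale /= fE muleC.
apply: (@g_sigma_algebra_measure_unique _ R Om (rect J) (@rect_measurable J)
  (fun=> setT) _ _ (mrestr P mE2) (mscale (NngNum f0) P) (@rect_setI J)) sE1.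
- by move=> _; exact: rect_setT.
- by apply/seteqP; split => // om _; exists 0%N.
- move=> E /h e; change (P (E `&` E2) = ((fine (P E2))%:E * P E)%E).
  by rewrite fE muleC.
- move=> _; change (P (setT `&` E2) < +oo)%E; rewrite setTI.
  by apply: le_lt_trans (probability_le1 P mE2) _; rewrite ltry.
Qed.

Lemma sigma_rect_indep J1 J2 E1 E2 : (forall i, J1 i -> ~~ J2 i) ->
  <<s rect J1 >> E1 -> <<s rect J2 >> E2 -> P (E1 `&` E2) = (P E1 * P E2)%E.
Proof.
move=> J12 s1 s2; have m2 := sigma_rect_measurable s2.
apply: half_indep s1 => // E r1.
rewrite setIC muleC; apply: half_indep s2.
  exact: rect_measurable r1.
by move=> E' r2; rewrite setIC muleC; exact: rect_indep r1 r2.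
Qed.

End BlockIndependence.

Section VisitEvents.
Variables (d : measure_display) (Om : measurableType d).
Variables (K : word -> Om -> nat) (Y : word -> nat -> Om -> nat).

(** The event whose probability is [hit_within] ([prob_vis]). *)
Definition vis (x o N M : nat) : set Om :=
  [set om | exists v : word, [/\ (N <= size v <= N + M)%N, in_tree K om v
                               & pos Y x om v = o]].

Hypothesis mK : forall w, measurable_fun [set: Om] (K w).
(** Restricted to nonempty words: in the subtree of child [i] this leaves out [Y [:: i]], and its
    events then lie in the sigma-algebra of [deep i]. *)
Hypothesis mY : forall i w y, measurable_fun [set: Om] (Y (i :: w) y).

Let preim (f : Om -> nat) (A : set nat) : measurable_fun [set: Om] f ->
  measurable (f @^-1` A).
Proof. by move=> mf; rewrite -[X in measurable X]setTI; exact: mf. Qed.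

Lemma measurable_in_tree v : measurable [set om | in_tree K om v].
Proof.
elim: v => [|i w ih] /=; first by rewrite (_ : mkset _ = setT)//; apply/seteqP; split.
have -> : [set om | (i < K w om)%N && in_tree K om w] =
    (K w @^-1` [set k | (i < k)%N]) `&` [set om | in_tree K om w].
  by apply/seteqP; split => [om /andP[]|om [? ?]] //; apply/andP.
by apply: measurableI => //; exact: preim.
Qed.

Lemma measurable_pos x v z : measurable [set om | pos Y x om v = z].
Proof.
elim: v z => [|i w ih] z /=.
  have [->|xz] := eqVneq x z.
    by rewrite (_ : mkset _ = setT)//; apply/seteqP; split.
  rewrite (_ : mkset _ = set0)//; apply/seteqP; split => // om /= /eqP.
  by rewrite (negbTE xz).
have -> : [set om | Y (i :: w) (pos Y x om w) om = z] =
   \bigcup_y ([set om | pos Y x om w = y] `&` (Y (i :: w) y @^-1` [set z])).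
  apply/seteqP; split => [om h|om [y _ [<-]]] //=.
  by exists (pos Y x om w).
apply: countable_bigcupT_measurable => // y; apply: measurableI => //.
exact: preim.
Qed.

Lemma measurable_vis x o N M : measurable (vis x o N M).
Proof.
have -> : vis x o N M = \bigcup_(v : word) (if (N <= size v <= N + M)%N then
   [set om | in_tree K om v] `&` [set om | pos Y x om v = o] else set0).
  apply/seteqP; split => [om [v [h1 h2 h3]]|om [v _]].
    by exists v => //; rewrite h1.
  by case: ifP => // h1 [h2 h3]; exists v.
apply: countable_bigcupT_measurable => [|v]; first exact: (@countableP (seq nat)).
case: ifP => // _.
by apply: measurableI; [exact: measurable_in_tree|exact: measurable_pos].
Qed.

End VisitEvents.

Section SubtreeWords.
Variables (T : Type) (K : word -> T -> nat) (Y : word -> nat -> T -> nat).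

(* [rcons]: words list the root-side letter last, as [in_tree] reads them. *)
Definition childK (i : nat) (w : word) := K (rcons w i).
Definition childY (i : nat) (w : word) := Y (rcons w i).

Lemma in_tree_rcons om w i :
  in_tree K om (rcons w i) = (i < K [::] om)%N && in_tree (childK i) om w.
Proof.
by elim: w => [|a w ih] //=; rewrite ih andbCA.
Qed.

Lemma pos_rcons x om w i :
  pos Y x om (rcons w i) = pos (childY i) (Y [:: i] x om) om w.
Proof. by elim: w => [|a w ih] //=; rewrite ih. Qed.

End SubtreeWords.

Definition brw_index := (word + word * nat)%type.

Definition index_word (j : brw_index) : word :=
  match j with inl w => w | inr vy => vy.1 end.

(** The last letter of a word names the child of the root from which it descends. *)
Definition child i : pred brw_index :=
  fun j => (index_word j != [::]) && (last 0%N (index_word j) == i).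

(** The indices at the root and those of the first [k] subtrees, disjoint from [child k]. *)
Definition below k : pred brw_index :=
  fun j => (index_word j == [::]) || (last 0%N (index_word j) < k)%N.

(* Indices of the [i]-th subtree apart from the step to its root. *)
Definition deep i : pred brw_index :=
  fun j => child i j && (if j is inr vy then 1 < size vy.1 else true)%N.

Lemma word_case (v : word) : v = [::] \/ exists w i, v = rcons w i.
Proof. by case: (lastP v) => [|w i]; [left|right; exists w, i]. Qed.

Section Branching.
Variables (R : realType) (g : graph) (p : nat -> R).
Variables (d : measure_display) (Om : measurableType d) (P : probability Om R).

(** The variables of a subtree are the original ones reindexed by the injection [iota], so laws and
    independence are inherited. *)
Lemma brw_realization_child (K : word -> Om -> nat) (Y : word -> nat -> Om -> nat) i :
  brw_realization g p P K Y ->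
  brw_realization g p P (childK K i) (childY Y i).
Proof.
move=> [mK mY lK lY ind]; split.
- by move=> w; exact: mK.
- by move=> v y; exact: mY.
- by move=> w k; exact: lK.
- by move=> v y z; exact: lY.
pose iota (j : brw_index) : brw_index :=
  match j with inl w => inl (rcons w i) | inr vy => inr (rcons vy.1 i, vy.2) end.
pose chop (w : word) := rev (behead (rev w)).
have chopK w : chop (rcons w i) = w by rewrite /chop rev_rcons /= revK.
pose pi (j : brw_index) : brw_index :=
  match j with inl w => inl (chop w) | inr vy => inr (chop vy.1, vy.2) end.
have iotaK : cancel iota pi by case=> [w|[v y]] /=; rewrite chopK.
have zE j : brw_var (childK K i) (childY Y i) j = brw_var K Y (iota j).
  by case: j.
move=> s us A.
have := ind (map iota s) _ (A \o pi); rewrite big_map (map_inj_uniq (can_inj iotaK)).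
move=> /(_ us) e.
transitivity (P (\bigcap_(j in [set` [seq iota i | i <- s]])
  (brw_var K Y j @^-1` (A \o pi) j))).
  congr (P _); apply/seteqP; split => [om h _ /mapP[j js ->]|om h j js].
    by rewrite /= iotaK -zE; exact: h.
  by have := h (iota j); rewrite /= iotaK zE; apply; exact: map_f.
by rewrite e; apply: eq_bigr => j _; rewrite /= iotaK zE.
Qed.

Section OneStep.
Variables (D : nat) (K : word -> Om -> nat) (Y : word -> nat -> Om -> nat).
Hypotheses (hp : offspring p) (bg : bdd_graph D g).
Hypothesis rKY : brw_realization g p P K Y.

Local Notation Z := (brw_var K Y).

Let mZ j : measurable_fun [set: Om] (Z j).
Proof. by case: rKY => mK mY _ _ _; case: j => [w|[v y]]; [exact: mK|exact: mY]. Qed.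

Let iZ : mutually_independent P Z. Proof. by case: rKY. Qed.

Variables (x : nat) (A : nat -> nat -> set Om) (a : nat -> R).
Hypothesis sA : forall i y, <<s rect Z (deep i) >> (A i y).
Hypothesis PA : forall i y, P (A i y) = (a y)%:E.

Let B i : set Om := [set om | A i (Y [:: i] x om) om].

Let BE i : B i = \bigcup_z ((Y [:: i] x @^-1` [set z]) `&` A i z).
Proof. by apply/seteqP; split => [om|om [z _ [/= <-]]] //; exists (Y [:: i] x om). Qed.

Let sigma_bigcup J (F : nat -> set Om) : (forall n, <<s rect Z J >> (F n)) ->
  <<s rect Z J >> (\bigcup_n F n).
Proof. by case: (smallest_sigma_algebra setT (rect Z J)) => _ _; apply. Qed.

Let sigma_setI J E F : <<s rect Z J >> E -> <<s rect Z J >> F ->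
  <<s rect Z J >> (E `&` F).
Proof. exact: (@measurableI _ (g_sigma_algebraType (rect Z J))). Qed.

Let sigma_rect1 (J : pred brw_index) j (C : set nat) :
  J j -> <<s rect Z J >> (Z j @^-1` C).
Proof.
by move=> Jj; have h := @rect1 _ Om _ Z J j C Jj; exact: sub_smallest h.
Qed.

Let sB i : <<s rect Z (child i) >> (B i).
Proof.
rewrite BE; apply: sigma_bigcup => z; apply: sigma_setI.
  by apply: (@sigma_rect1 _ (inr ([:: i], x))); rewrite /child /=.
by move: (@sA i z); apply: sigma_rectS => j /andP[].
Qed.

Let a_ge0 y : 0 <= a y.
Proof. by rewrite -lee_fin -(PA 0). Qed.

(** Condition on the position of child [i], which is independent of [A i z] since [deep i] omits
    that step. *)
Let PB i : P (B i) = (avg g a x)%:E.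
Proof.
have mA z : measurable (A i z) by exact: sigma_rect_measurable (@sA i z).
have mYz z : measurable (Y [:: i] x @^-1` [set z]).
  by rewrite -[X in measurable X]setTI; exact: (mZ (inr ([:: i], x))).
rewrite BE measure_semi_bigcup//; last 3 first.
- by move=> z; exact: measurableI.
- apply/trivIsetP => z1 z2 _ _ z12; apply/seteqP; split => // om [[/= e1 _] [/= e2 _]].
  by move: z12; rewrite -e1 -e2 eqxx.
- by apply: bigcupT_measurable => z; exact: measurableI.
transitivity (\sum_(z <oo) (if z \in g x then srw R g x z * a z else 0)%:E)%E.
  apply: eq_eseriesr => z _.
  have sYz : <<s rect Z (pred1 (inr ([:: i], x))) >> (Y [:: i] x @^-1` [set z]).
    by apply: (@sigma_rect1 _ (inr ([:: i], x))); rewrite /= eqxx.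
  have dj j : pred1 (inr ([:: i], x)) j -> ~~ deep i j.
    by move=> /eqP ->; rewrite /deep /= andbF.
  have := sigma_rect_indep mZ iZ dj sYz (@sA i z).
  case: rKY => _ _ _ lY _; rewrite PA lY -EFinM => e; apply: (etrans e); rewrite /srw.
  by case: ifP => //; rewrite mul0r.
rewrite (@nneseries_seq _ (fun z => srw R g x z * a z))//.
  exact: bdd_graph_uniq bg _.
by move=> z; rewrite mulr_ge0 ?srw_ge0.
Qed.

(** Induction on [j]: the event built so far lives on [below j] and [B j] on [child j]. *)
Let Pk k j : P ((K [::] @^-1` [set k]) `&` [set om | forall i, (i < j)%N -> B i om]) =
  (p k * avg g a x ^+ j)%:E.
Proof.
have step m : [set om | forall i, (i < m.+1)%N -> B i om] =
    [set om | forall i, (i < m)%N -> B i om] `&` B m.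
  apply/seteqP; split => om.
    by move=> h; split => [i im|]; apply: h => //; exact: ltnW.
  by move=> [h Bm] i; rewrite ltnS leq_eqVlt => /predU1P[->|/h].
pose E m := (K [::] @^-1` [set k]) `&` [set om | forall i, (i < m)%N -> B i om].
have sE m : <<s rect Z (below m) >> (E m).
  elim: m => [|m ih].
    rewrite /E (_ : [set om | _] = setT) ?setIT.
      by apply: (@sigma_rect1 _ (inl [::])); rewrite /below.
    by apply/seteqP; split.
  rewrite /E step setIA; apply: sigma_setI.
    move: ih; apply: sigma_rectS => j'; rewrite /below => /orP[->//|h].
    by rewrite (ltn_trans h) ?orbT.
  move: (@sB m); apply: sigma_rectS => j'; rewrite /child /below => /andP[_ /eqP ->].
  by rewrite ltnSn orbT.
elim: j => [|j ih].
  rewrite (_ : [set om | forall i, _ -> _] = setT) ?setIT; last by apply/seteqP; split.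
  by case: rKY => _ _ lK _ _; rewrite lK expr0 mulr1.
have dj j' : below j j' -> ~~ child j j'.
  rewrite /below /child => /orP[->//|h].
  by rewrite negb_and orbC neq_ltn h.
rewrite step setIA; have := sigma_rect_indep mZ iZ dj (@sE j) (@sB j).
by rewrite [P (E j)]ih PB -EFinM => e; apply: (etrans e); rewrite exprSr mulrA.
Qed.

Lemma branching : P [set om | forall i, (i < K [::] om)%N -> A i (Y [:: i] x om) om] =
  (pgf p (avg g a x))%:E.
Proof.
have a1 y : a y <= 1.
  rewrite -lee_fin -(PA 0); apply: probability_le1.
  exact: sigma_rect_measurable (@sA 0%N y).
have mB i : measurable (B i) by exact: sigma_rect_measurable (@sB i).
have mE k : measurable ((K [::] @^-1` [set k]) `&`
    [set om | forall i, (i < k)%N -> B i om]).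
  apply: measurableI.
    by rewrite -[X in measurable X]setTI; exact: (mZ (inl [::])).
  have -> : [set om | forall i, (i < k)%N -> B i om] =
      \bigcap_(i in [set i | (i < k)%N]) B i.
    by apply/seteqP; split.
  exact: bigcap_measurableType.
have -> : [set om | forall i, (i < K [::] om)%N -> A i (Y [:: i] x om) om] =
   \bigcup_k ((K [::] @^-1` [set k]) `&` [set om | forall i, (i < k)%N -> B i om]).
  apply/seteqP; split => [om h|om [k _ [/= <-]]] //.
  by exists (K [::] om).
rewrite measure_semi_bigcup//; last 2 first.
- apply/trivIsetP => z1 z2 _ _ z12; apply/seteqP; split => // om [[/= e1 _] [/= e2 _]].
  by move: z12; rewrite -e1 -e2 eqxx.
- exact: bigcupT_measurable.
rewrite pgfE//; last by rewrite avg_ge0// avg_le1.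
by apply: eq_eseriesr => k _; exact: Pk.
Qed.

End OneStep.

End Branching.

(** * Visits of the branching random walk *)

Section VisitProbability.
Variables (R : realType) (D : nat) (g : graph) (p : nat -> R).
Variables (d : measure_display) (Om : measurableType d) (P : probability Om R).
Hypotheses (hp : offspring p) (bg : bdd_graph D g).
Variable o : nat.

(** The strict bound [n < size v] excludes the root, so [v] passes through a child. *)
Lemma visit_child (K : word -> Om -> nat) (Y : word -> nat -> Om -> nat) om x n m :
  (exists v : word, [/\ (n < size v <= m.+1)%N, in_tree K om v & pos Y x om v = o]) <->
  (exists2 i, (i < K [::] om)%N & exists w : word,
     [/\ (n <= size w <= m)%N, in_tree (childK K i) om w
       & pos (childY Y i) (Y [:: i] x om) om w = o]).
Proof.
split=> [[v [/andP[nv vm] tv pv]]|[i iK [w [h tw pw]]]]; last first.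
  by exists (rcons w i); rewrite size_rcons in_tree_rcons pos_rcons iK.
have [v0|[w [i vE]]] := word_case v; first by rewrite v0 in nv.
move: nv vm tv pv; rewrite vE size_rcons in_tree_rcons pos_rcons => nv vm /andP[iK tw] pw.
by exists i => //; exists w; split=> //; apply/andP.
Qed.

(** [branching] applied to the complements: no visit occurs exactly when every child's subtree
    avoids [o]. *)
Lemma prob_vis_step (K : word -> Om -> nat) (Y : word -> nat -> Om -> nat) x N M
    (h : nat -> R) (E : set Om) :
  brw_realization g p P K Y ->
  (forall i y, P (vis (childK K i) (childY Y i) y o N M) = (h y)%:E) ->
  (forall om, E om <-> exists2 i, (i < K [::] om)%N &
     vis (childK K i) (childY Y i) (Y [:: i] x om) o N M om) ->
  P E = (pgfc p (avg g h x))%:E.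
Proof.
move=> rKY hP hE; have [mK mY _ _ _] := rKY.
pose A i y := ~` vis (childK K i) (childY Y i) y o N M.
have sA i y : <<s rect (brw_var K Y) (deep i) >> (A i y).
  apply: (@measurableC _ (g_sigma_algebraType (rect (brw_var K Y) (deep i)))).
  apply: measurable_vis => [w|j w z] _ B _; rewrite setTI; apply: sub_sigma_algebra.
    by apply: (@rect1 _ _ _ (brw_var K Y) _ (inl (rcons w i)));
      rewrite /deep /child /= last_rcons eqxx; case: w.
  by apply: (@rect1 _ _ _ (brw_var K Y) _ (inr (rcons (j :: w) i, z)));
    rewrite /deep /child /= last_rcons eqxx size_rcons.
have mv i y : measurable (vis (childK K i) (childY Y i) y o N M).
  by apply: measurable_vis => *; [exact: mK|exact: mY].
have PA i y : P (A i y) = (1 - h y)%:E.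
  by rewrite probability_setC ?hP.
have := branching hp bg rKY x sA PA.
set C := [set om | _] => PC.
have mC : measurable C.
  have -> : C = \bigcap_i (~` [set om | (i < K [::] om)%N] `|`
      \bigcup_y ((Y [:: i] x @^-1` [set y]) `&` A i y)).
    apply/seteqP; split=> [om Com i _|om h1 i iK].
      have [iK|] := boolP (i < K [::] om)%N; last by move=> /negP; left.
      by right; exists (Y [:: i] x om) => //; split => //; exact: Com.
    by have [//|[y _ [<-]]] := h1 i Logic.I.
  apply: bigcapT_measurable => i; apply: measurableU.
    apply: measurableC; rewrite -[X in measurable X]setTI.
    exact: (mK [::] measurableT [set k | (i < k)%N]).
  apply: bigcupT_measurable => y; apply: measurableI.
    by rewrite -[X in measurable X]setTI; exact: mY.
  exact: measurableC.
have -> : E = ~` C.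
  apply/seteqP; split=> om; first by move=> /hE[i iK vi] /(_ i iK).
  move=> nC; apply/hE; apply: contrapT => hn; apply: nC => i iK vi.
  by apply: hn; exists i.
rewrite probability_setC// PC -EFinB /pgfc; congr (_ - pgf p _)%:E.
by rewrite avgB (avg_cst bg).
Qed.

Lemma prob_vis (K : word -> Om -> nat) (Y : word -> nat -> Om -> nat) x N M :
  brw_realization g p P K Y ->
  P (vis K Y x o N M) = (hit_within p g o N M x)%:E.
Proof.
elim: N K Y x => [|N ih] K Y x rKY; last first.
  apply: (prob_vis_step (N := N) (M := M) rKY) => [i y|om].
    by apply: ih; exact: brw_realization_child.
  exact: visit_child.
elim: M K Y x rKY => [|M ih] K Y x rKY /=.
  have -> : vis K Y x o 0 0 = if x == o then setT else set0.
    apply/seteqP; split=> om.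
      by move=> [v [/andP[_ +] _ <-]]; case: v => //= _; rewrite eqxx.
    by case: eqP => // xo _; exists [::].
  by case: eqP => _; rewrite ?probability_setT ?measure0.
have [->|xo] := eqVneq x o.
  rewrite (_ : vis _ _ _ _ _ _ = setT) ?probability_setT//.
  by apply/seteqP; split => // om _; exists [::].
apply: (prob_vis_step (N := 0) (M := M) rKY) => [i y|om].
  by apply: ih; exact: brw_realization_child.
(* The root sits at [x != o], so the window may start at generation 1. *)
apply: (iff_trans _ (@visit_child K Y om x 0 M)); split=> -[v [vM tv pv]].
  by exists v; split=> //; case: v pv tv vM => //= /eqP; rewrite (negbTE xo).
by exists v; split=> //; case/andP: vM.
Qed.

Lemma finite_level (K : word -> Om -> nat) om n :
  finite_set [set v : word | in_tree K om v /\ size v = n].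
Proof.
elim: n => [|n ih].
  by apply: (@sub_finite_set _ _ [set [::]]) => // v [_ /size0nil].
apply: (@sub_finite_set _ _ (\bigcup_(w in [set v : word | in_tree K om v /\ size v = n])
   [set i :: w | i in `I_(K w om)])).
  move=> [[_ //]|i w [/= /andP[iw tw] [sw]]]; by exists w => //; exists i.
by apply: bigcup_finite => // w _; apply: finite_image; exact: finite_II.
Qed.

(** Generations are finite, so infinitely many visits reach arbitrarily late ones; finitely many
    visits have a maximal depth. *)
Lemma visits_ioE (K : word -> Om -> nat) (Y : word -> nat -> Om -> nat) :
  visits_io K Y o = \bigcap_N \bigcup_M vis K Y o o N M.
Proof.
apply/seteqP; split=> [om inf N _|om h fin].
  apply: contrapT => nh; apply: inf.
  apply: (@sub_finite_set _ _ (\bigcup_(n in `I_N)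
    [set v : word | in_tree K om v /\ size v = n])).
    move=> v [tv pv]; exists (size v) => //=; rewrite ltnNge; apply/negP => Nv.
    apply: nh; exists (size v) => //; exists v; split=> //.
    by rewrite Nv leq_addl.
  by apply: bigcup_finite => // n _; exact: finite_level.
move: fin => /finite_seqP[s sE].
pose n := (\max_(v <- s) size v).+1.
have [M _ [v [/andP[nv _] tv pv]]] := h n Logic.I.
have vs : v \in s.
  by have : [set` s] v by rewrite -sE.
suff : (size v < n)%N by rewrite ltnNge nv.
by rewrite ltnS; exact: leq_bigmax_seq vs _.
Qed.

(** Continuity of [P] from below in [M], then from above in [N], matches the limits defining
    [hit_io]. *)
Lemma prob_visits_io (K : word -> Om -> nat) (Y : word -> nat -> Om -> nat) :
  brw_realization g p P K Y ->
  P (visits_io K Y o) = (hit_io p g o o)%:E.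
Proof.
move=> rKY; have [mK mY _ _ _] := rKY.
have mvis N M : measurable (vis K Y o o N M).
  by apply: measurable_vis => *; [exact: mK|exact: mY].
have mU N : measurable (\bigcup_M vis K Y o o N M) by exact: bigcupT_measurable.
have PU N : P (\bigcup_M vis K Y o o N M) = (hit_after p g o N o)%:E.
  have h1 : P (vis K Y o o N M) @[M --> \oo] --> P (\bigcup_M vis K Y o o N M).
    apply: nondecreasing_cvg_mu => // M M' MM'.
    apply/subsetPset => om [v [/andP[Nv vM] tv pv]].
    exists v; split=> //; rewrite Nv; apply: leq_trans vM _.
    by rewrite leq_add2l.
  have h2 : P (vis K Y o o N M) @[M --> \oo] --> (hit_after p g o N o)%:E.
    under eq_fun do rewrite prob_vis//.
    by apply: cvg_EFin; [exact: nearW|exact: hit_within_cvg].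
  exact: cvg_unique h1 h2.
rewrite visits_ioE.
have h1 : P (\bigcup_M vis K Y o o N M) @[N --> \oo] -->
    P (\bigcap_N \bigcup_M vis K Y o o N M).
  apply: nonincreasing_cvg_mu => //.
  - by apply: le_lt_trans (probability_le1 P (mU _)) _; rewrite ltry.
  - exact: bigcapT_measurable.
  - move=> N N' NN'; apply/subsetPset => om [M _ [v [/andP[Nv vM] tv pv]]].
    exists (N' + M)%N => //; exists v; split=> //; apply/andP; split.
      exact: leq_trans Nv.
    by apply: leq_trans vM _; rewrite leq_addl.
have h2 : P (\bigcup_M vis K Y o o N M) @[N --> \oo] --> (hit_io p g o o)%:E.
  under eq_fun do rewrite PU.
  by apply: cvg_EFin; [exact: nearW|exact: hit_after_cvg].
exact: cvg_unique h1 h2.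
Qed.

End VisitProbability.

Theorem theorem2p2 (R : realType) (nu : probability Gr R) (p : nat -> R) :
  (exists D : nat, {ae nu, forall g : Gr, bdd_graph D g}) ->
  unimodular nu ->
  offspring p ->
  {ae nu, forall g : Gr,
    forall (d : measure_display) (Om : measurableType d) (P : probability Om R)
           (K : word -> Om -> nat) (Y : word -> nat -> Om -> nat),
      brw_realization g p P K Y ->
      ((mean p > ((rho R g)^-1)%:E)%E ->
         forall x : nat, P (visits_io K Y x) = 1%E) /\
      ((mean p <= ((rho R g)^-1)%:E)%E ->
         forall x : nat, P (visits_io K Y x) = 0%E)}.
Proof.
move=> [D bnu] unu hp.
(* Both properties concern [g] alone, so one null set serves all realizations. *)
apply: (ae_imp2 _ bnu (hit_all_01_law hp unu bnu)) => g bg law d Om P K Y rKY.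
split=> [rm x|mr x]; rewrite (prob_visits_io hp bg x rKY); last first.
  by rewrite (hit_io_transient _ hp bg mr).
have all0 := hit_all_supercritical hp bg rm.
case: law => all1; first by rewrite all1 ltxx in all0.
(* The value 1 of [hit_all] at the root covers every target [x]; [hit_io_eq1] moves the start from 0
   to [x]. *)
congr EFin; apply: (hit_io_eq1 hp bg (x := 0%N)); apply/eqP; rewrite eq_le.
have := hit_all_le hp g x 0; rewrite all1 => ->; rewrite andbT.
by case/andP: (hit_io_01 hp g x 0).
Qed.
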